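(* Let $k$ be an algebraically closed field of characteristic $p>0$, let $\mathcal{E}$ be an elementary abelian group scheme over $k$, let $j\in\{1,\ldots,p-1\}$, and let $M$ be a finite-dimensional $k\mathcal{E}$-module of constant $j$-rank. Let $U_{\mathcal{E}}=\{[u]\in\mathbb{P}(\mathrm{Rad}(k\mathcal{E})) : u\notin\mathrm{Rad}^2(k\mathcal{E})\}$. Then: (1) The map $\mathrm{Im}^j_M:U_{\mathcal{E}}\to\mathrm{Gr}_{\mathrm{rk}^j(M)}(M)$, $[u]\mapsto\mathrm{im}(u_M^j)$, is a homogeneous morphism. (2) If $\mathcal{E}$ has abelian unipotent rank $\ge 2$ and $V\subseteq\mathrm{Rad}(k\mathcal{E})$ is a subspace such that $\mathrm{Rad}(k\mathcal{E})=V\oplus\mathrm{Rad}^2(k\mathcal{E})$, then $\mathbb{P}(V)\subseteq U_{\mathcal{E}}$, and \[ \deg(\mathrm{pl}_M\circ\mathrm{Im}^j_M)=\deg(\mathrm{pl}_M\circ\mathrm{Im}^j_M|_{\mathbb{P}(V)}).\]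
   Context: $k\mathcal{E}=k[\mathcal{E}]^\ast$ is the algebra of measures of $\mathcal{E}$; for $u\in k\mathcal{E}$, $u_M$ is the operator $m\mapsto um$ on $M$. An abelian finite group scheme $\mathcal{E}$ is elementary abelian if it is a product $\mathcal{E}=\mathcal{E}_1\cdots\mathcal{E}_n$ of subgroups, each isomorphic to a Frobenius kernel $\mathbb{G}_{a(r_i)}$ of the additive group or to the constant group $\mathbb{Z}/(p)$. Then $k\mathcal{E}\cong k[X_1,\ldots,X_n]/(X_1^p,\ldots,X_n^p)$ as an algebra for a unique $n$, which is the abelian unipotent rank of $\mathcal{E}$. Let $\mathfrak{A}_p=k[T]/(T^p)$, $t=T+(T^p)$. A $p$-point of $\mathcal{E}$ is an algebra homomorphism $\alpha:\mathfrak{A}_p\to k\mathcal{E}$ making $k\mathcal{E}$ a projective $\mathfrak{A}_p$-module; via $\alpha\mapsto\alpha(t)$, the $p$-points correspond to the elements of $\mathrm{Rad}(k\mathcal{E})\setminus\mathrm{Rad}^2(k\mathcal{E})$. $\mathrm{rk}^j(M)$ is the maximum of $\mathrm{rk}(\alpha(t)_M^j)$ over all $p$-points, and $M$ has constant $j$-rank if $\mathrm{rk}(\alpha(t)_M^j)=\mathrm{rk}^j(M)$ for all $p$-points $\alpha$. $U_{\mathcal{E}}$ is open in the projective space $\mathbb{P}(\mathrm{Rad}(k\mathcal{E}))$. $\mathrm{Gr}_d(M)$ is the Grassmannian of $d$-dimensional subspaces ($\mathrm{Gr}_0(M)$ is a point), regarded as a closed subvariety of $\mathbb{P}(\bigwedge^d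 M)$ via the Plücker embedding $\mathrm{pl}_M$. A morphism $\varphi:X\to Y$ of quasi-projective varieties $X\subseteq\mathbb{P}^n$, $Y\subseteq\mathbb{P}^m$ is homogeneous if there are homogeneous polynomials $f_0,\ldots,f_m\in k[X_0,\ldots,X_n]$ of the same degree, without common zero on $X$, with $\varphi(x)=(f_0(x):\cdots:f_m(x))$ for all $x\in X$. If $X$ is a non-empty open subset of $\mathbb{P}^n$, every morphism $X\to\mathbb{P}^m$ is homogeneous and the $f_i$ may be chosen with $\gcd(f_0,\ldots,f_m)=1$; they are then unique up to a common non-zero scalar and $\deg(\varphi)$ is their common degree (applied here to $U_{\mathcal{E}}\subseteq\mathbb{P}(\mathrm{Rad}(k\mathcal{E}))$ and to $\mathbb{P}(V)$). *)

(* Defs.v *)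
From HB Require Import structures.
From mathcomp Require Import all_boot all_order all_algebra all_field.
From mathcomp Require Import boolp.
From mathcomp Require Import mpoly zify.

Set Implicit Arguments.
Unset Strict Implicit.
Unset Printing Implicit Defensive.

Import GRing.Theory.
Local Open Scope ring_scope.

(* Tensor products are taken in coordinates with respect to the bases         *)
(* vbasis {:U} and vbasis {:V}.                                               *)

Section Tensor.
Variable k : fieldType.
Implicit Types U V W : vectType k.

Definition tens U V := 'M[k]_(\dim {:U}, \dim {:V}).
HB.instance Definition _ U V := Vector.on (tens U V).

Definition tensor U V (u : U) (v : V) : tens U V :=
  \matrix_(i, j) (coord (vbasis {:U}) i u * coord (vbasis {:V}) j v).

(* For bilinear f, the linear map U (x) V -> W with u (x) v |-> f u v. Thus   *)
(* tlift f (comul b) reads "\sum f(b_(1), b_(2))" in Sweedler notation.       *)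
Definition tlift U V W (f : U -> V -> W) (t : tens U V) : W :=
  \sum_i \sum_j t i j *: f (vbasis {:U})`_i (vbasis {:V})`_j.

Lemma tlift_tensor U V W (f : U -> V -> W) u v :
  (forall v, linear (f^~ v)) -> (forall u, linear (f u)) ->
  tlift f (tensor u v) = f u v.
Proof.
move=> fl fr.
have fl' v0 : forall I (r : seq I) (c : I -> k) (F : I -> U),
    f (\sum_(i <- r) c i *: F i) v0 = \sum_(i <- r) c i *: f (F i) v0.
  move=> I r c F; elim: r => [|i r IH].
    by rewrite !big_nil; have := fl v0 (-1) 0 0; rewrite scaler0 add0r scaleN1r addNr.
  by rewrite !big_cons fl IH.
have fr' u0 : forall I (r : seq I) (c : I -> k) (F : I -> V),
    f u0 (\sum_(i <- r) c i *: F i) = \sum_(i <- r) c i *: f u0 (F i).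
  move=> I r c F; elim: r => [|i r IH].
    by rewrite !big_nil; have := fr u0 (-1) 0 0; rewrite scaler0 add0r scaleN1r addNr.
  by rewrite !big_cons fr IH.
rewrite [in RHS](coord_vbasis (memvf u)) fl'; apply: eq_bigr => i _.
rewrite [in RHS](coord_vbasis (memvf v)) fr' scaler_sumr.
by apply: eq_bigr => j _; rewrite mxE scalerA.
Qed.

Lemma tlift_is_linear U V W (f : U -> V -> W) : linear (tlift f).
Proof.
move=> a s t; rewrite /tlift scaler_sumr -big_split; apply: eq_bigr => i _ /=.
rewrite scaler_sumr -big_split; apply: eq_bigr => j _ /=.
by rewrite !mxE scalerDl scalerA.
Qed.
HB.instance Definition _ U V W (f : U -> V -> W) :=
  GRing.isLinear.Build k (tens U V) W *:%R (tlift f) (tlift_is_linear f).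

Lemma linear_tlift U V W (X : vectType k) (g : {linear W -> X})
    (f : U -> V -> W) t :
  g (tlift f t) = tlift (fun u v => g (f u v)) t.
Proof.
rewrite /tlift linear_sum; apply: eq_bigr => i _.
by rewrite linear_sum; apply: eq_bigr => j _; rewrite linearZ.
Qed.

Lemma eq_tlift U V W (f g : U -> V -> W) t :
  (forall u v, f u v = g u v) -> tlift f t = tlift g t.
Proof. by move=> fg; apply: eq_bigr => i _; apply: eq_bigr => j _; rewrite fg. Qed.

End Tensor.

(* A finite group scheme E over k, given by its coordinate Hopf algebra k[E]. *)
Record finGroupScheme (k : fieldType) := FinGroupScheme {
  coord_ring : falgType k;
  comul : {linear coord_ring -> tens coord_ring coord_ring};
  counit : {lrmorphism coord_ring -> k^o};
  antipode : {linear coord_ring -> coord_ring};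
  coord_mulC : forall a b : coord_ring, a * b = b * a;
  comul1 : comul 1 = tensor 1 1;
  comulM : forall a b, comul (a * b) =
    tlift (fun a1 a2 => tlift (fun b1 b2 => tensor (a1 * b1) (a2 * b2))
                              (comul b)) (comul a);
  comulA : forall b,
    tlift (fun b12 b3 => tlift (fun b1 b2 => tensor b1 (tensor b2 b3))
                               (comul b12)) (comul b)
    = tlift (fun b1 b23 => tensor b1 (comul b23)) (comul b);
  counitl : forall b, tlift (fun b1 b2 => (counit b1 : k) *: b2) (comul b) = b;
  counitr : forall b, tlift (fun b1 b2 => (counit b2 : k) *: b1) (comul b) = b;
  antipodel : forall b,
    tlift (fun b1 b2 => antipode b1 * b2) (comul b) = (counit b : k)%:A;
  antipoder : forall b,
    tlift (fun b1 b2 => b1 * antipode b2) (comul b) = (counit b : k)%:A }.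

(* The algebra of measures kE = k[E]^*: the dual space, with the convolution  *)
(* product and unit the counit of k[E].                                       *)
Definition measures (k : fieldType) (E : finGroupScheme k) :=
  'Hom(coord_ring E, k^o).
HB.instance Definition _ k (E : finGroupScheme k) := Vector.on (measures E).

Section Measures.
Variables (k : fieldType) (E : finGroupScheme k).
Local Notation B := (coord_ring E).
Implicit Types (x y z : measures E) (b : B).

Definition conv_fun x y b : k^o :=
  tlift (fun b1 b2 => x b1 * y b2 : k^o) (comul E b).

Fact conv_fun_is_linear x y : linear (conv_fun x y).
Proof. by move=> a b c; rewrite /conv_fun !linearP. Qed.
HB.instance Definition _ x y :=
  GRing.isLinear.Build k B k^o *:%R (conv_fun x y) (conv_fun_is_linear x y).

Definition conv x y : measures E := linfun (conv_fun x y).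
Definition measure1 : measures E := linfun (counit E).

Lemma convE x y b :
  conv x y b = tlift (fun b1 b2 => x b1 * y b2 : k^o) (comul E b).
Proof. by rewrite lfunE. Qed.

Let ev x y : {linear tens B B -> k^o} :=
  tlift (fun b1 b2 => x b1 * y b2 : k^o).

Let evT x y b1 b2 : ev x y (tensor b1 b2) = x b1 * y b2.
Proof.
apply: tlift_tensor => [v|u] a b c.
  by rewrite linearP mulrDl -scalerAl.
by rewrite linearP mulrDr -scalerAr.
Qed.

Fact convA : associative conv.
Proof.
move=> x y z; apply/lfunP => b; rewrite !convE.
pose F : {linear tens B (tens B B) -> k^o} :=
  tlift (fun a s => x a * ev y z s : k^o).
have FT a s : F (tensor a s) = x a * ev y z s.
  apply: tlift_tensor => [v|u] c b1 b2.
    by rewrite linearP mulrDl -scalerAl.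
  by rewrite linearP mulrDr -scalerAr.
have := congr1 F (comulA b); rewrite !linear_tlift => eqF.
transitivity (tlift (fun b1 b23 => F (tensor b1 (comul E b23))) (comul E b)).
  by apply: eq_tlift => b1 b2; rewrite FT convE.
rewrite -eqF; apply: eq_tlift => b12 b3.
rewrite linear_tlift convE.
rewrite -[RHS]/(tlift (fun b1 b2 => x b1 * y b2 : k^o) (comul E b12) * z b3).
rewrite /tlift mulr_suml; apply: eq_bigr => i _.
rewrite mulr_suml; apply: eq_bigr => j _.
by rewrite FT evT mulrA scalerAl.
Qed.

Fact conv1x : left_id measure1 conv.
Proof.
move=> x; apply/lfunP => b; rewrite convE -[in RHS](counitl b) linear_tlift.
by apply: eq_tlift => b1 b2; rewrite linearZ lfunE.
Qed.

Fact convx1 : right_id measure1 conv.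
Proof.
move=> x; apply/lfunP => b; rewrite convE -[in RHS](counitr b) linear_tlift.
by apply: eq_tlift => b1 b2; rewrite linearZ lfunE /= mulrC.
Qed.

Fact convDl : left_distributive conv +%R.
Proof.
move=> x y z; apply/lfunP => b; rewrite add_lfunE !convE /tlift -big_split.
apply: eq_bigr => i _; rewrite -big_split; apply: eq_bigr => j _ /=.
by rewrite add_lfunE mulrDl scalerDr.
Qed.

Fact convDr : right_distributive conv +%R.
Proof.
move=> x y z; apply/lfunP => b; rewrite add_lfunE !convE /tlift -big_split.
apply: eq_bigr => i _; rewrite -big_split; apply: eq_bigr => j _ /=.
by rewrite add_lfunE mulrDr scalerDr.
Qed.

Fact measure1_neq0 : measure1 != 0.
Proof.
apply/eqP => /lfunP/(_ 1)/eqP; rewrite zero_lfunE lfunE rmorph1.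
by rewrite oner_eq0.
Qed.
HB.instance Definition _ := GRing.Zmodule_isNzRing.Build (measures E)
  convA conv1x convx1 convDl convDr measure1_neq0.

Fact convZl (a : k) x y : a *: (x * y) = (a *: x) * y.
Proof.
apply/lfunP => b; rewrite scale_lfunE !convE /tlift /= scaler_sumr.
apply: eq_bigr => i _; rewrite scaler_sumr; apply: eq_bigr => j _.
by rewrite scale_lfunE -scalerAl !scalerA [a * _]mulrC.
Qed.
HB.instance Definition _ :=
  GRing.Lmodule_isLalgebra.Build k (measures E) convZl.
Fact convZr (a : k) x y : a *: (x * y) = x * (a *: y).
Proof.
apply/lfunP => b; rewrite scale_lfunE !convE /tlift /= scaler_sumr.
apply: eq_bigr => i _; rewrite scaler_sumr; apply: eq_bigr => j _.
by rewrite scale_lfunE -scalerAr !scalerA [a * _]mulrC.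
Qed.
HB.instance Definition _ :=
  GRing.Lalgebra_isAlgebra.Build k (measures E) convZr.
HB.instance Definition _ := Algebra_isFalgebra.Build k (measures E).

Lemma measureM x y b :
  (x * y) b = tlift (fun b1 b2 => x b1 * y b2 : k^o) (comul E b).
Proof. exact: convE. Qed.

End Measures.

Section Subgroups.
Variables (k : fieldType) (E F : finGroupScheme k).
Implicit Type pi : {lrmorphism coord_ring E -> coord_ring F}.

(* pi is the comorphism k[E] -> k[F] of a closed embedding of groups F -> E;  *)
(* compatibility with counits and antipodes is automatic.                     *)
Definition closed_subgroup pi :=
  (forall b, comul F (pi b)
             = tlift (fun b1 b2 => tensor (pi b1) (pi b2)) (comul E b))
  /\ (forall c, exists b, pi b = c).

Definition push_measure pi (x : measures F) : measures E :=
  (x \o linfun pi)%VF.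

Fact push_measure_is_linear pi : linear (push_measure pi).
Proof.
by move=> a x y; rewrite /push_measure comp_lfunDl comp_lfunZl.
Qed.
HB.instance Definition _ pi :=
  GRing.isLinear.Build k (measures F) (measures E) *:%R (push_measure pi)
    (push_measure_is_linear pi).

Lemma push_measureE pi x b : push_measure pi x b = x (pi b).
Proof. by rewrite comp_lfunE lfunE. Qed.

Definition subgroup_measures pi : {vspace measures E} :=
  limg (linfun (push_measure pi)).

End Subgroups.

Section ElementaryAbelian.
Variables (k : fieldType) (p : nat).
Implicit Type E F : finGroupScheme k.

Definition abelian_scheme E := forall b,
  comul E b = tlift (fun b1 b2 => tensor b2 b1) (comul E b).

(* F is isomorphic to G_a(r): k[G_a(r)] = k[T]/(T^(p^r)), with T primitive.   *)
Definition is_Ga_kernel (r : nat) F :=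
  exists2 f : {lrmorphism {poly %/ ('X^(p ^ r) : {poly k})} -> coord_ring F},
    bijective f
  & comul F (f 'qX) = tensor (f 'qX) 1 + tensor 1 (f 'qX).

(* F is isomorphic to the constant group Z/(p), whose coordinate ring is the  *)
(* ring of functions Z/(p) -> k, with (comul h)(a, b) = h(a + b).             *)
Definition is_constant_Zp F :=
  exists f : {linear {ffun 'Z_p -> k^o} -> coord_ring F},
    [/\ bijective f,
        f [ffun=> 1] = 1,
        forall g h : {ffun 'Z_p -> k^o}, f [ffun a => g a * h a] = f g * f h
      & forall h : {ffun 'Z_p -> k^o}, comul F (f h) = \sum_a \sum_b
          h (a + b) *: tensor (f [ffun c => (c == a)%:R])
                              (f [ffun c => (c == b)%:R])].

(* E = E_1 ... E_n means that the multiplication E_1 x ... x E_n -> E is an   *)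
(* epimorphism, i.e. that kE is the product of its subalgebras kE_i.          *)
Definition elementary_abelian E :=
  abelian_scheme E /\
  exists (n : nat) (F : 'I_n -> finGroupScheme k)
         (pi : forall i, {lrmorphism coord_ring E -> coord_ring (F i)}),
    [/\ forall i, closed_subgroup (pi i),
        forall i, (exists r, is_Ga_kernel r (F i)) \/ is_constant_Zp (F i)
      & \big[@prodv k (measures E)/1%VS]_(i < n) subgroup_measures (pi i)
        = fullv].

(* kE is isomorphic to k[X_1, ..., X_n]/(X_1^p, ..., X_n^p) as an algebra.    *)
Definition abelian_unipotent_rank E (n : nat) :=
  exists phi : {lrmorphism {mpoly k[n]} -> measures E},
    (forall x, exists q, phi q = x) /\
    (forall q, phi q = 0 <->
       exists g : 'I_n -> {mpoly k[n]}, q = \sum_i g i * 'X_i ^+ p).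

End ElementaryAbelian.

Section Radical.
Variables (k : fieldType) (A : falgType k).

Definition maximal_left_ideal (m : {vspace A}) :=
  [/\ (fullv * m <= m)%VS, m <> fullv
    & forall m', (fullv * m' <= m')%VS -> (m <= m')%VS ->
        m' = m \/ m' = fullv].

Lemma Rad_subproof : exists J : {vspace A},
  forall u, u \in J <-> forall m, maximal_left_ideal m -> u \in m.
Proof.
pose P u := forall m, maximal_left_ideal m -> u \in m.
suff H n (W : {vspace A}) : (\dim {:A} - \dim W <= n)%N ->
    (forall u, u \in W -> P u) -> exists J : {vspace A}, forall u, u \in J <-> P u.
  apply: (H _ 0%VS (leqnn _)) => u; rewrite memv0 => /eqP-> m _; exact: mem0v.
elim: n W => [|n IH] W leWn sWP.
  exists W => u; split; first exact: sWP.
  move=> _; suff -> : W = fullv by rewrite memvf.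
  by apply/eqP; rewrite eqEdim subvf -subn_eq0 -leqn0.
have [[u [Pu uW]]|nex] := pselect (exists u, P u /\ u \notin W); last first.
  exists W => u; split; first exact: sWP.
  by move=> Pu; apply: contrapT => /negP uW; apply: nex; exists u.
apply: (IH (W + <[u]>)%VS).
  have ltW : (\dim W < \dim (W + <[u]>))%N.
    rewrite ltn_neqAle dimvS ?addvSl // andbT; apply: contra uW => /eqP eqW.
    have /eqP-> : W == (W + <[u]>)%VS by rewrite eqEdim addvSl -eqW leqnn.
    by rewrite (subvP (addvSr _ _)) ?memv_line.
  have := dimvS (subvf (W + <[u]>)%VS); lia.
move=> v /memv_addP[w wW [x /vlineP[c ->] ->]] m Hm.
by rewrite rpredD ?rpredZ ?(sWP _ wW) ?Pu.
Qed.

Definition Rad : {vspace A} := sval (cid Rad_subproof).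

Lemma RadP u : u \in Rad <-> forall m, maximal_left_ideal m -> u \in m.
Proof. exact: (svalP (cid Rad_subproof) u). Qed.

End Radical.

Definition projective (R : nzRingType) (P : lmodType R) : Prop :=
  forall (N Q : lmodType R) (g : {linear N -> Q}) (f : {linear P -> Q}),
    (forall y, exists x, g x = y) ->
    exists h : {linear P -> N}, forall x, g (h x) = f x.

Definition restrict_scalars (R A : nzRingType) (f : {rmorphism R -> A}) : Type :=
  A.

Section RestrictScalars.
Variables (R A : nzRingType) (f : {rmorphism R -> A}).
HB.instance Definition _ := GRing.Zmodule.on (restrict_scalars f).

Definition restrict_scale (a : R) (x : restrict_scalars f) :
  restrict_scalars f := (f a * (x : A) : A).

Fact restrict_scaleA a b x :
  restrict_scale a (restrict_scale b x) = restrict_scale (a * b) x.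
Proof. by rewrite /restrict_scale rmorphM mulrA. Qed.

Fact restrict_scale1 : left_id 1 restrict_scale.
Proof. by move=> x; rewrite /restrict_scale rmorph1 mul1r. Qed.

Fact restrict_scaleDr : right_distributive restrict_scale +%R.
Proof. by move=> a x y; exact: mulrDr. Qed.

Fact restrict_scaleDl x : {morph restrict_scale^~ x : a b / a + b}.
Proof. by move=> a b; rewrite /restrict_scale rmorphD; exact: mulrDl. Qed.
HB.instance Definition _ := GRing.Zmodule_isLmodule.Build R
  (restrict_scalars f) restrict_scaleA restrict_scale1 restrict_scaleDr
  restrict_scaleDl.
End RestrictScalars.

Notation truncated_poly k p := {poly %/ ('X^p : {poly k})}.

Definition is_ppoint (k : fieldType) (p : nat) (E : finGroupScheme k)
    (alpha : {lrmorphism truncated_poly k p -> measures E}) : Prop :=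
  projective (restrict_scalars alpha).

Record fdModule (k : fieldType) (A : falgType k) := FdModule {
  fd_carrier :> vectType k;
  act : {linear A -> 'End(fd_carrier)};
  act1 : act 1 = \1%VF;
  actM : forall a b, act (a * b) = (act a \o act b)%VF }.

(* u_M is act M u, and act_pow M u j is u_M^j.                                *)
Definition act_pow (k : fieldType) (A : falgType k) (M : fdModule A) (u : A)
    (j : nat) : 'End(M) :=
  iter j (comp_lfun (act M u)) \1%VF.

Section JRank.
Variables (k : fieldType) (p : nat) (E : finGroupScheme k).
Variables (M : fdModule (measures E)) (j : nat).

Definition ppoint_rank
    (alpha : {lrmorphism truncated_poly k p -> measures E}) : nat :=
  \dim (limg (act_pow M (alpha 'qX) j)).

(* The maximum of rk(alpha(t)_M^j) over all p-points alpha (0 if there are    *)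
(* none, i.e. if E is trivial).                                               *)
Definition jrank : nat :=
  \max_(r < (\dim {:M}).+1 |
        `[< exists2 alpha, is_ppoint alpha & ppoint_rank alpha = r >]) r.

Definition constant_jrank : Prop :=
  forall alpha, is_ppoint alpha -> ppoint_rank alpha = jrank.

End JRank.

Section ProjectiveGeometry.
Variables (k : fieldType) (V : vectType k).

(* The points of P(W) are the lines in W.                                     *)
Definition proj_space (W : {vspace V}) : {pred {vspace V}} :=
  [pred L | (L <= W)%VS && (\dim L == 1)%N].

Variables (W : {vspace V}) (I : finType).
(* Points of P(W) have homogeneous coordinates with respect to vbasis W; the  *)
(* target projective space is that of k^I.                                    *)
Implicit Types (X : {pred {vspace V}}) (f : I -> {mpoly k[\dim W]}).
Implicit Types (phi : {vspace V} -> {vspace {ffun I -> k^o}}).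

Definition hcoord (u : V) : 'I_(\dim W) -> k := fun i => coord (vbasis W) i u.

Definition heval f (u : V) : {ffun I -> k^o} := [ffun i => (f i).@[hcoord u]].

Definition represents X phi f :=
  forall u, <[u]>%VS \in X ->
    heval f u != 0 /\ phi <[u]>%VS = <[heval f u]>%VS.

(* phi is a morphism on X <= P(W): around every point it is given by          *)
(* homogeneous polynomials of the same degree. Basic open sets suffice.       *)
Definition is_morphism X phi :=
  forall u, <[u]>%VS \in X ->
    exists (g : {mpoly k[\dim W]}) (c : nat) f (d : nat),
    [/\ g \is c.-homog, g.@[hcoord u] != 0,
        forall i, f i \is d.-homog
      & forall v, <[v]>%VS \in X -> g.@[hcoord v] != 0 ->
          heval f v != 0 /\ phi <[v]>%VS = <[heval f v]>%VS].

Definition is_homogeneous X phi :=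
  is_morphism X phi /\
  exists f (d : nat), (forall i, f i \is d.-homog) /\ represents X phi f.

(* In k[X_1, ..., X_n], the units are the non-zero constants.                 *)
Definition gcd_one f := forall h : {mpoly k[\dim W]},
  (forall i, exists q, f i = h * q) -> h \is a GRing.unit.

Definition reduced_representation X phi f (d : nat) :=
  [/\ forall i, f i \is d.-homog, represents X phi f & gcd_one f].

(* phi has reduced representations, all of them of degree d.                  *)
Definition has_degree X phi (d : nat) :=
  (exists f, reduced_representation X phi f d) /\
  (forall f e, reduced_representation X phi f e -> e = d).

End ProjectiveGeometry.

Section Grassmannian.
Variables (k : fieldType) (M : vectType k) (d : nat).

Definition Gr : {pred {vspace M}} := [pred W | \dim W == d].

Definition dsubset : finType :=
  {S : {set 'I_(\dim {:M})} | #|S| == d}.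

(* The d-th exterior power of M, in the basis e_{s_1} ^ ... ^ e_{s_d} for     *)
(* S = {s_1 < ... < s_d} and (e_s) the basis vbasis {:M} of M.                *)
Definition exterior := {ffun dsubset -> k^o}.

Definition wedge (w : seq M) : exterior :=
  [ffun S : dsubset => \det (\matrix_(a < #|val S|, b < #|val S|)
     coord (vbasis {:M}) (enum_val b) w`_a)].

Definition pluecker (W : {vspace M}) : {vspace exterior} :=
  <[wedge (vbasis W)]>%VS.

End Grassmannian.

Section ImageMap.
Variables (k : fieldType) (E : finGroupScheme k).
Local Notation kE := (measures E).

Definition Rad2 : {vspace kE} := (Rad kE * Rad kE)%VS.

Definition U_set : {pred {vspace kE}} :=
  [pred L | (L \in proj_space (Rad kE)) && ~~ (L <= Rad2)%VS].

Variables (M : fdModule kE) (j : nat).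

(* By Im_mapE below, the choice of a representative of L is irrelevant.       *)
Definition Im_map (L : {vspace kE}) : {vspace M} := limg (act_pow M (vpick L) j).

Lemma Im_mapE (u : kE) : u != 0 -> Im_map <[u]>%VS = limg (act_pow M u j).
Proof.
have actZ (c : k) v i : act_pow M (c *: v) i = c ^+ i *: act_pow M v i.
  elim: i => [|i IH]; first by rewrite expr0 scale1r.
  rewrite /act_pow !iterS -!/(act_pow _ _ _) IH linearZ -comp_lfunZl.
  by rewrite -comp_lfunZr scalerA -exprS.
move=> u0; rewrite /Im_map.
have /vlineP[c vE] : vpick <[u]>%VS \in <[u]>%VS by exact: memv_pick.
have c0 : c != 0.
  apply: contraNneq u0 => c0; move: vE; rewrite c0 scale0r => /eqP.
  by rewrite vpick0 -subv0 -memvE memv0.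
rewrite vE actZ; apply/vspaceP => w; apply/memv_imgP/memv_imgP => -[v _ ->].
  by exists (c ^+ j *: v); rewrite ?memvf // scale_lfunE linearZ.
exists (c ^- j *: v); rewrite ?memvf // scale_lfunE linearZ scalerA.
by rewrite divff ?scale1r // expf_neq0.
Qed.

Lemma in_U_set (u : kE) :
  (<[u]>%VS \in U_set) = (u \in Rad kE) && (u \notin Rad2).
Proof.
rewrite !inE -!memvE dim_vline; have [->|_] := eqVneq u 0; last by rewrite andbT.
by rewrite !mem0v !andbF.
Qed.

End ImageMap.

Arguments Rad {k} A.
Arguments Rad2 {k} E.
Arguments U_set {k} E.
Arguments Gr {k} M d.

(* Main.v *)
(* Every u in Rad(kE) has u^p = 0, and if u is not in Rad^2(kE) a linear form *)
(* on kE that is 1 at u and vanishes on k + Rad^2(kE) is a primitive element  *)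
(* of k[E]. It acts on kE as a derivation D with D(u) invertible, and then    *)
(* Higman's criterion with D^(p-1) shows that kE is projective over k[u], so  *)
(* that u comes from a p-point and u_M^j has the generic rank d.              *)
(*                                                                            *)
(* The d-minors of u_M^j in fixed columns are forms in u; for two choices of  *)
(* columns they are proportional, since they are the Pluecker coordinates of  *)
(* the same subspace. As k[X_1, ..., X_n] has gcds, all of them are multiples *)
(* of one reduced family, which therefore has no common zero on U_E.          *)
(*                                                                            *)
(* If U_E is the complement of a subspace of codimension at least 2, a common *)
(* factor without zeros on U_E is constant along the lines contained in U_E,  *)
(* hence constant. So representations without common zeros are reduced, and   *)
(* restricting such a representation to V gives one of the same degree.       *)

Require Import Defs.
From HB Require Import structures.
From mathcomp Require Import all_boot all_order all_algebra all_field.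
From mathcomp Require Import boolp.
From mathcomp Require Import mpoly.
From mathcomp Require Import fingroup perm ring zify.

Set Implicit Arguments.
Unset Strict Implicit.
Unset Printing Implicit Defensive.

Import GRing.Theory.
Local Open Scope ring_scope.

(** * Greatest common divisors in polynomial rings *)

Section GcdDomain.
Variable R : idomainType.
Implicit Types (c d g x : R) (p q : {poly R}).

Definition divides a b := exists c, b = a * c.

Definition gauss_coprime a b := forall x, divides a (b * x) -> divides a x.

Definition gcd_domain := forall a b, a != 0 ->
  exists g a' b', [/\ a = g * a', b = g * b' & gauss_coprime a' b'].

Definition parallel (I : Type) (f b : I -> R) :=
  forall i j, f i * b j = f j * b i.

Definition primitive_family (I : Type) (f : I -> R) :=
  (exists i, f i != 0) /\
  forall b, parallel f b -> exists h, forall i, b i = f i * h.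

Lemma primitive_family_unit (I : Type) (f f' : I -> R) c :
  primitive_family f -> (forall i, f i = c * f' i) -> c \is a GRing.unit.
Proof.
move=> [[i fi0] fP] fE; have c0 : c != 0.
  by apply: contraNneq fi0 => c0; rewrite fE c0 mul0r.
case: (fP f') => [i1 i2|h hE]; first by rewrite !fE -!mulrA; congr (c * _); ring.
apply/unitrPr; exists h; apply: (mulfI fi0); rewrite mulr1.
by rewrite mulrCA -hE -fE.
Qed.

Hypothesis gcdR : gcd_domain.

Lemma primitive_part (I : finType) (a : I -> R) : (exists i, a i != 0) ->
  exists g f, (forall i, a i = g * f i) /\ primitive_family f.
Proof.
suff H (r : seq I) : uniq r ->
    (forall i, i \in r -> a i = 0) \/
    exists g (f : I -> R), [/\ forall i, i \in r -> a i = g * f i,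
      exists2 i, i \in r & f i != 0, g != 0
      & forall b, {in r &, forall i j, f i * b j = f j * b i} ->
          exists h, forall i, i \in r -> b i = f i * h].
  case=> i0 ai0; case: (H _ (enum_uniq I)) => [a0|[g [f [aE [i _ fi] g0 fP]]]].
    by rewrite a0 ?mem_enum ?eqxx // in ai0.
  exists g, f; split=> [l|]; first by rewrite aE ?mem_enum.
  split=> [|b bP]; first by exists i.
  case: (fP b) => [? ? _ _|h hE]; first exact: bP.
  by exists h => l; rewrite hE ?mem_enum.
elim: r => [_|i0 r IH /= /andP[i0r ur]]; first by left.
have [ai0|ai0] := eqVneq (a i0) 0.
  case: (IH ur) => [a0|[g [f [aE [i ir fi] g0 fP]]]].
    by left=> i; rewrite inE => /predU1P[->|/a0].
  have Ni j : j \in r -> (j == i0) = false.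
    by move=> jr; apply/negbTE; apply: contraNneq i0r => <-.
  right; exists g, (fun i => if i == i0 then 0 else f i); split=> //.
  - move=> j; rewrite inE => /predU1P[->|jr]; first by rewrite eqxx mulr0.
    by rewrite Ni // aE.
  - by exists i; rewrite ?inE ?ir ?orbT // Ni.
  move=> b bP; case: (fP b) => [j l jr lr|h hE].
    by have := bP j l; rewrite !Ni //; apply; rewrite inE ?jr ?lr orbT.
  exists h => j; rewrite inE => /predU1P[->|jr]; last by rewrite Ni ?hE.
  have := bP i i0 (@mem_behead _ (i0 :: r) i ir) (mem_head _ _); rewrite eqxx Ni // !mul0r.
  by move/eqP; rewrite mulf_eq0 (negbTE fi) /= => /eqP.
right; case: (IH ur) => [a0|[g [f [aE [i ir fi] g0 fP]]]].
  exists (a i0), (fun i => (i == i0)%:R); split=> //.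
  - move=> j; rewrite inE => /predU1P[->|jr]; first by rewrite eqxx mulr1.
    rewrite a0 //; case: eqP => [ej|_]; last by rewrite mulr0.
  by rewrite ej (negbTE i0r) in jr.
  - by exists i0; rewrite ?inE ?eqxx ?oner_eq0.
  move=> b bP; exists (b i0) => j jr; have := bP i0 j (mem_head _ _) jr.
  by rewrite eqxx mul1r.
have Ni j : j \in r -> (j == i0) = false.
  by move=> jr; apply/negbTE; apply: contraNneq i0r => <-.
have [h [u [v [uE vE uvP]]]] := gcdR g ai0.
have h0 : h != 0 by apply: contraNneq ai0 => h0; rewrite uE h0 mul0r.
have v0 : v != 0 by apply: contraNneq g0 => v0; rewrite vE v0 mulr0.
exists h, (fun i => if i == i0 then u else v * f i); split=> //.
- move=> j; rewrite inE => /predU1P[->|jr]; first by rewrite eqxx.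
  by rewrite Ni // aE // mulrA -vE.
- by exists i; rewrite ?inE ?ir ?orbT // Ni // mulf_neq0.
move=> b bP; case: (fP b) => [j l jr lr|s sE].
  have := bP j l; rewrite !Ni // !inE jr lr !orbT => /(_ isT isT).
  by rewrite -!mulrA => /(mulfI v0).
have : u * s = v * b i0.
  have := bP i0 i; rewrite eqxx Ni // !inE eqxx ir orbT sE // => /(_ isT isT).
  rewrite mulrCA [v * _]mulrC -mulrA => /(mulfI fi); exact.
move=> eqs; case: (uvP (b i0)) => [|t tE]; first by exists s; rewrite eqs.
have u0 : u != 0 by apply: contraNneq ai0 => u0; rewrite uE u0 mulr0.
have sE' : s = v * t by apply: (mulfI u0); rewrite eqs tE; ring.
exists t => j; rewrite inE => /predU1P[->|jr]; first by rewrite eqxx.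
by rewrite Ni // sE // sE'; ring.
Qed.

Definition primitive p := forall c, (exists q, p = c *: q) -> c \is a GRing.unit.

Lemma scale_poly_coef c p : (forall i, divides c p`_i) -> exists q, p = c *: q.
Proof.
move=> cp; exists (\poly_(i < size p) sval (cid (cp i))).
apply/polyP => i; rewrite coefZ coef_poly; case: ltnP => [_|?].
  exact: svalP (cid (cp i)).
by rewrite mulr0 nth_default.
Qed.

Lemma primitive_neq0 p : primitive p -> p != 0.
Proof.
move=> pP; apply/eqP => p0; have := pP 0; rewrite unitr0 => H.
by apply: notF; apply: H; exists 0; rewrite p0 scaler0.
Qed.

Lemma content_primitive p : p != 0 ->
  exists c q, p = c *: q /\ primitive q.
Proof.
move=> p0; case: (@primitive_part 'I_(size p) (fun i => p`_i)) => [|g [f [pE fP]]].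
  have sp : ((size p).-1 < size p)%N by rewrite ltn_predL size_poly_gt0.
  by exists (Ordinal sp); rewrite /= -lead_coefE lead_coef_eq0.
exists g, (\poly_(i < size p) odflt 0 (omap f (insub i))); split.
  apply/polyP => i; rewrite coefZ coef_poly; case: ltnP => ip.
    by rewrite insubT /= -(pE (Ordinal ip)).
  by rewrite mulr0 nth_default.
move=> c [q qE]; apply: (@primitive_family_unit _ f (fun i => q`_i) c fP) => i.
have := congr1 (fun r : {poly R} => r`_i) qE.
by rewrite coefZ coef_poly ltn_ord valK /=.
Qed.

Lemma scale_polyI c : c != 0 -> injective (fun p => c *: p).
Proof. by move=> c0 p q; rewrite -!mul_polyC; apply: mulfI; rewrite polyC_eq0. Qed.

Lemma size_sub_lead p : p != 0 ->
  (size (p - lead_coef p *: 'X^((size p).-1))%R < size p)%N.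
Proof.
move=> p0; have sp : (0 < size p)%N by rewrite size_poly_gt0.
rewrite -[X in (_ < X)%N](prednK sp) ltnS; apply/leq_sizeP => i.
rewrite leq_eqVlt coefB coefZ coefXn => /predU1P[<-|ip].
  by rewrite eqxx mulr1 lead_coefE subrr.
by rewrite (gtn_eqF ip) mulr0 subr0 nth_default // -(prednK sp).
Qed.

(* Peel off the leading terms: if (c, lead_coef p) = e (c', a'), then c'      *)
(* divides lead_coef q, while e divides p minus its leading term.             *)
Lemma dvd_primitive_mul c p q :
  c != 0 -> (forall e, divides e c -> (exists r, p = e *: r) -> e \is a GRing.unit) ->
  (exists r, p * q = c *: r) -> exists r, q = c *: r.
Proof.
have [n] := ubnP (size p + size q); elim: n c p q => // n IH c p q.
rewrite ltnS => le_n c0 cp [r rE].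
have [q0|q0] := eqVneq q 0; first by exists 0; rewrite q0 scaler0.
have [p0|p0] := eqVneq p 0.
  have cu : c \is a GRing.unit.
    by apply: cp; [exists 1; rewrite mulr1|exists 0; rewrite p0 scaler0].
  by exists (c^-1 *: q); rewrite scalerA divrr ?scale1r.
have [e [c' [a' [cE aE c'P]]]] := gcdR (lead_coef p) c0.
have e0 : e != 0 by apply: contraNneq c0 => e0; rewrite cE e0 mul0r.
have c'0 : c' != 0 by apply: contraNneq c0 => c'0; rewrite cE c'0 mulr0.
have [b' bE] : divides c' (lead_coef q).
  apply: c'P; exists (r`_(size p + size q).-2); apply: (mulfI e0).
  rewrite !mulrA -aE -cE -[c * _]coefZ -rE -lead_coefM lead_coefE size_mul //.
have [q' q'E] : exists r, q = c' *: r.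
  set q1 := q - lead_coef q *: 'X^((size q).-1).
  have [|||q1' q1E] := IH c' p q1 _ c'0.
  - by rewrite (leq_trans _ le_n) // ltn_add2l size_sub_lead.
  - move=> d [x dx]; apply: cp; exists (e * x).
    by rewrite cE dx; ring.
  - exists (e *: r - b' *: (p * 'X^((size q).-1))).
    rewrite /q1 mulrBr rE bE scalerBr cE !scalerA mulrC -scalerAr.
    by congr (_ - _); rewrite -!scalerAr.
  exists (q1' + b' *: 'X^((size q).-1)).
  by rewrite scalerDr -q1E scalerA -bE subrK.
have q'0 : q' != 0 by apply: contraNneq q0 => q'0; rewrite q'E q'0 scaler0.
suff [q'' q''E] : exists r, q' = e *: r.
  by exists q''; rewrite q'E q''E scalerA cE mulrC.
set p1 := p - lead_coef p *: 'X^((size p).-1).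
have pE : p = p1 + lead_coef p *: 'X^((size p).-1) by rewrite subrK.
apply: (IH e p1) => //.
- rewrite (leq_trans _ le_n) // q'E size_scale // ltn_add2r.
  exact: size_sub_lead.
- move=> d [x ex] [s sE]; apply: cp; first by exists (x * c'); rewrite cE ex; ring.
  exists (s + (x * a') *: 'X^((size p).-1)).
  by rewrite scalerDr scalerA mulrA -ex -aE -sE subrK.
- exists (r - a' *: ('X^((size p).-1) * q')).
  have : p * q' = e *: r.
    apply: (scale_polyI c'0).
    by rewrite scalerAr -q'E rE cE scalerA mulrC.
  rewrite /p1 mulrBl => ->; rewrite scalerBr scalerA -aE -scalerAl //.
Qed.

Lemma dvd_primitive c p q : c != 0 -> primitive p ->
  (exists r, p * q = c *: r) -> exists r, q = c *: r.
Proof. by move=> c0 pP; apply: dvd_primitive_mul => // e _; exact: pP. Qed.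

Lemma dvdp_primitive p q : primitive p -> p %| q -> exists s, q = p * s.
Proof.
move=> pP /Pdiv.Idomain.dvdpP[[c s] /= c0 qE].
have [s' sE] : exists r, s = c *: r.
  by apply: (dvd_primitive c0 pP); exists q; rewrite mulrC.
exists s'; apply: (scale_polyI c0).
by rewrite qE sE -scalerAl mulrC.
Qed.
End GcdDomain.

Section GcdPoly.
Variable R : idomainType.
Hypothesis gcdR : gcd_domain R.

Lemma gcd_domain_poly : gcd_domain {poly R}.
Proof.
move=> a b a0; have [b0|b0] := eqVneq b 0.
  exists a, 1, 0; split; rewrite ?mulr1 ?mulr0 //.
  by move=> x _; exists x; rewrite mul1r.
have g0 : gcdp a b != 0 by rewrite gcdp_eq0 negb_and a0.
have [c [g [gE gP]]] := content_primitive gcdR g0.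
have c0 : c != 0 by apply: contraNneq g0 => c0; rewrite gE c0 scale0r.
have gp0 := primitive_neq0 gP.
have ga : g %| a by rewrite -(dvdpZl _ _ c0) -gE dvdp_gcdl.
have gb : g %| b by rewrite -(dvdpZl _ _ c0) -gE dvdp_gcdr.
have [a1 aE] := dvdp_primitive gcdR gP ga.
have [b1 bE] := dvdp_primitive gcdR gP gb.
have a10 : a1 != 0 by apply: contraNneq a0 => z; rewrite aE z mulr0.
have b10 : b1 != 0 by apply: contraNneq b0 => z; rewrite bE z mulr0.
have cop1 : coprimep a1 b1.
  have := gcdp_mul2l g a1 b1; rewrite -aE -bE => /eqp_size.
  rewrite size_mul ?gcdp_eq0 ?negb_and ?a10 // gE size_scale // coprimep_def.
  have : (0 < size g)%N by rewrite size_poly_gt0.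
  have : (0 < size (gcdp a1 b1))%N by rewrite size_poly_gt0 gcdp_eq0 negb_and a10.
  by move=> ? ? ?; lia.
have [al [a2 [a1E a2P]]] := content_primitive gcdR a10.
have [be [b2 [b1E b2P]]] := content_primitive gcdR b10.
have al0 : al != 0 by apply: contraNneq a10 => z; rewrite a1E z scale0r.
have be0 : be != 0 by apply: contraNneq b10 => z; rewrite b1E z scale0r.
have cop2 : coprimep a2 b2 by move: cop1; rewrite a1E b1E coprimepZl ?coprimepZr.
have [ga' [u [v [uE vE uvP]]]] := gcdR be al0.
have u0 : u != 0 by apply: contraNneq al0 => z; rewrite uE z mulr0.
exists (ga' *: g), (u *: a2), (v *: b2); split.
- by rewrite aE a1E uE -!scalerAr -scalerAl scalerA mulrC.
- by rewrite bE b1E vE -!scalerAr -scalerAl scalerA mulrC.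
move=> x [y yE].
have a2x : a2 %| x.
  rewrite -(Gauss_dvdpr x cop2).
  have v0 : v != 0 by apply: contraNneq be0 => z; rewrite vE z mulr0.
  by rewrite -(dvdpZr _ _ v0) scalerAl yE -scalerAl dvdpZr // dvdp_mulr.
have [x' xE] := dvdp_primitive gcdR a2P a2x.
have a20 := primitive_neq0 a2P.
have e1 : v *: (b2 * x') = u *: y.
  by apply: (mulfI a20); rewrite -scalerAr mulrCA -xE scalerAl yE -scalerAl scalerAr.
have [s sE] : exists r, b2 * x' = u *: r.
  apply: scale_poly_coef => i; apply: uvP; exists y`_i.
  by rewrite -!coefZ e1.
have [t tE] : exists r, x' = u *: r.
  by apply: (dvd_primitive gcdR u0 b2P); exists s.
by exists t; rewrite xE tE -scalerAr scalerAl.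
Qed.
End GcdPoly.

Lemma gcd_domain_field (k : fieldType) : gcd_domain k.
Proof.
move=> a b a0; exists a, 1, (b / a); split; rewrite ?mulr1 ?divff //.
  by rewrite mulrC divfK.
by move=> x _; exists x; rewrite mul1r.
Qed.

Lemma gcd_domain_bij (R S : idomainType) (f : {rmorphism R -> S}) :
  bijective f -> gcd_domain S -> gcd_domain R.
Proof.
move=> [g fK gK] gcdS a b a0.
have gM x y : g (x * y) = g x * g y by apply: (can_inj fK); rewrite rmorphM !gK.
have fa0 : f a != 0 by rewrite -(rmorph0 f) (inj_eq (can_inj fK)).
have [d [u [v [uE vE uvP]]]] := gcdS _ (f b) fa0.
exists (g d), (g u), (g v); split; rewrite -?gM -?uE -?vE ?fK //.
move=> x [y yE]; case: (uvP (f x)) => [|z zE].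
  by exists (f y); apply: (can_inj gK); rewrite !gM !fK.
by exists (g z); rewrite -gM -zE fK.
Qed.

Section MpolyGcd.
Variables (k : fieldType) (n : nat).

Definition poly_mpoly (p : {poly {mpoly k[n]}}) : {mpoly k[n.+1]} :=
  (map_poly (@mwiden n k) p).['X_ord_max].
Local Notation inv := poly_mpoly.

Lemma muni_widenX (i : 'I_n) : muni ('X_(widen_ord (leqnSn n) i) : {mpoly k[n.+1]}) = ('X_i)%:P.
Proof.
rewrite /muni mmapX mmap1U; case: splitP => j /= ij.
  by congr ('X_ _)%:P; apply: val_inj.
by have := ltn_ord i; rewrite ij ltnNge leq_addr.
Qed.

Lemma muni_maxX : muni ('X_ord_max : {mpoly k[n.+1]}) = 'X.
Proof.
rewrite /muni mmapX mmap1U; case: splitP => j //= nj.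
by have := ltn_ord j; rewrite -nj ltnn.
Qed.

Lemma muni_mwiden (q : {mpoly k[n]}) : muni (mwiden q) = q%:P.
Proof.
elim/mpolyind: q => [|c m q _ _ IH]; first by rewrite mwiden0 muni0.
rewrite mwidenD muniD IH mwidenZ muniZ polyCD; congr (_ + _).
rewrite -mul_mpolyC polyCM mul_polyC; congr (_ *: _).
rewrite mwidenX !mpolyXE_id !rmorph_prod big_ord_recr /=.
rewrite mnmwiden_ordmax expr0 rmorph1 mulr1; apply: eq_bigr => i _.
by rewrite mnmwiden_widen !rmorphXn /= muni_widenX.
Qed.

Lemma poly_mpolyD p q : inv (p + q) = inv p + inv q.
Proof. by rewrite /poly_mpoly raddfD hornerD. Qed.

Lemma poly_mpolyM p q : inv (p * q) = inv p * inv q.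
Proof. by rewrite /poly_mpoly rmorphM hornerM. Qed.

Lemma poly_mpolyC c : inv c%:P = mwiden c.
Proof. by rewrite /poly_mpoly map_polyC hornerC. Qed.

Lemma poly_mpolyX : inv 'X = 'X_ord_max.
Proof. by rewrite /poly_mpoly map_polyX hornerX. Qed.

Lemma poly_mpoly_muniX m : inv (muni 'X_[m]) = 'X_[m].
Proof.
have invXn p i : inv (p ^+ i) = inv p ^+ i.
  by elim: i => [|i IH]; rewrite ?exprS ?poly_mpolyM ?IH // !expr0 -polyC1 poly_mpolyC mwiden1.
have inv_prod (I : Type) (r : seq I) (F : I -> {poly {mpoly k[n]}}) :
    inv (\prod_(i <- r) F i) = \prod_(i <- r) inv (F i).
  elim: r => [|i r IH]; last by rewrite !big_cons poly_mpolyM IH.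
  by rewrite !big_nil -polyC1 poly_mpolyC mwiden1.
rewrite [in RHS]mpolyXE_id [in LHS]mpolyXE_id (rmorph_prod (@muni n k)) inv_prod.
apply: eq_bigr => i _; rewrite (rmorphXn (@muni n k)) invXn; congr (_ ^+ _).
have [j ->|->] := unliftP ord_max i; last by rewrite /= muni_maxX poly_mpolyX.
have -> : lift ord_max j = widen_ord (leqnSn n) j.
  by apply: val_inj; rewrite /= /bump leqNgt ltn_ord.
by rewrite /= muni_widenX poly_mpolyC mwidenX mnmwiden1.
Qed.

Lemma muniK : cancel (@muni n k) poly_mpoly.
Proof.
elim/mpolyind => [|c m q _ _ IH]; first by rewrite muni0 -polyC0 poly_mpolyC mwiden0.
rewrite muniD poly_mpolyD; congr (_ + _); last exact: IH.
by rewrite muniZ -mul_polyC poly_mpolyM poly_mpoly_muniX poly_mpolyC mwidenC mul_mpolyC.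
Qed.

Lemma poly_mpolyK : cancel poly_mpoly (@muni n k).
Proof.
elim/poly_ind => [|p c IH]; first by rewrite -polyC0 poly_mpolyC mwiden0 muni0.
by rewrite poly_mpolyD poly_mpolyM poly_mpolyC poly_mpolyX muniD muniM IH muni_maxX muni_mwiden.
Qed.
End MpolyGcd.

Lemma mpoly0K (k : fieldType) (v : 'I_0 -> k) : cancel (meval v) (@mpolyC 0 k).
Proof.
move=> p; have pE : p = (p@_0)%:MP.
  apply/mpolyP => m; rewrite mcoeffC; have -> : m = 0%MM by apply/mnmP => -[].
  by rewrite eqxx mulr1.
by rewrite pE mevalC.
Qed.

Lemma gcd_domain_mpoly (k : fieldType) n : gcd_domain {mpoly k[n]}.
Proof.
elim: n => [|n IH].
  have bij : bijective (meval (fun=> 0) : {rmorphism {mpoly k[0]} -> k}).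
    by exists (@mpolyC 0 k); [exact: mpoly0K|exact: mevalC].
  exact: (gcd_domain_bij bij (@gcd_domain_field k)).
exact: (gcd_domain_bij (Bijective (@muniK k n) (@poly_mpolyK k n)) (gcd_domain_poly IH)).
Qed.

(** * The algebra of measures and its radical *)

Lemma tliftDl (k : fieldType) (U V W : vectType k) (f g : U -> V -> W) t :
  tlift (fun u v => f u v + g u v) t = tlift f t + tlift g t.
Proof.
rewrite /tlift -big_split; apply: eq_bigr => i _ /=.
by rewrite -big_split; apply: eq_bigr => j _ /=; rewrite scalerDr.
Qed.

Lemma iter_derivation (R : nzRingType) (D : {additive R -> R}) n :
  (forall x y, D (x * y) = D x * y + x * D y) -> forall x y,
  iter n D (x * y) = \sum_(i < n.+1) (iter i D x * iter (n - i) D y) *+ 'C(n, i).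
Proof.
move=> DM x y; elim: n => [|n IH]; first by rewrite big_ord1.
rewrite iterS IH raddf_sum [LHS](eq_bigr (fun i : 'I_n.+1 =>
  (iter i.+1 D x * iter (n - i) D y) *+ 'C(n, i) +
  (iter i D x * iter (n - i).+1 D y) *+ 'C(n, i))); last first.
  by move=> i _; rewrite raddfMn /= DM // mulrnDl.
rewrite big_split /= [X in _ + X]big_ord_recl [RHS]big_ord_recl /=.
rewrite !subn0 !bin0 addrCA; congr (_ + _).
rewrite [in RHS](eq_bigr (fun i : 'I_n.+1 =>
  (iter i.+1 D x * iter (n - i) D y) *+ 'C(n, i) +
  (iter i.+1 D x * iter (n - i) D y) *+ 'C(n, i.+1))); last first.
  by move=> i _; rewrite /bump leq0n add1n subSS binS mulrnDr addrC.
rewrite big_split /=; congr (_ + _).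
rewrite [RHS]big_ord_recr /= bin_small // mulr0n addr0.
by apply: eq_bigr => i _; rewrite /bump leq0n add1n -!iterS subnSK.
Qed.

Section MeasureAlgebra.
Variables (k : fieldType) (E : finGroupScheme k).
Local Notation B := (coord_ring E).
Implicit Types (x y z : measures E) (b : B).

Lemma measure1E b : (1 : measures E) b = counit E b.
Proof. by rewrite lfunE. Qed.

Lemma tlift_measures x y b1 b2 :
  tlift (fun b1 b2 => x b1 * y b2 : k^o) (tensor b1 b2) = x b1 * y b2.
Proof.
apply: tlift_tensor => [v|u] a b c.
  by rewrite linearP mulrDl -scalerAl.
by rewrite linearP mulrDr -scalerAr.
Qed.

Lemma measureM1 x y : (x * y) 1 = x 1 * y 1.
Proof. by rewrite measureM comul1 tlift_measures. Qed.

Lemma measure11 : (1 : measures E) 1 = 1.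
Proof. by rewrite measure1E rmorph1. Qed.

Lemma measureX1 x n : (x ^+ n) 1 = x 1 ^+ n.
Proof. by elim: n => [|n IH]; rewrite ?measure11 // !exprS measureM1 IH. Qed.

Lemma measuresC : abelian_scheme E -> forall x y, x * y = y * x.
Proof.
move=> abE x y; apply/lfunP => b; rewrite !measureM [in LHS]abE linear_tlift.
by apply: eq_tlift => b1 b2; rewrite /= tlift_measures mulrC.
Qed.

Definition shift_fun b x (c : B) : k^o := x (c * b).

Fact shift_fun_is_linear b x : linear (shift_fun b x).
Proof. by move=> a c d; rewrite /shift_fun mulrDl -scalerAl linearP. Qed.
HB.instance Definition _ b x :=
  GRing.isLinear.Build k B k^o *:%R (shift_fun b x) (shift_fun_is_linear b x).

Definition shift b x : measures E := linfun (shift_fun b x).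

Lemma shiftE b x c : shift b x c = x (c * b).
Proof. by rewrite lfunE. Qed.

Fact shift_is_linear b : linear (shift b).
Proof. by move=> a x y; apply/lfunP => c; rewrite !(shiftE, add_lfunE, scale_lfunE). Qed.
HB.instance Definition _ b :=
  GRing.isLinear.Build k (measures E) (measures E) *:%R (shift b) (shift_is_linear b).

Definition primitive_elt b := comul E b = tensor b 1 + tensor 1 b.

(* A primitive function is an additive character E -> G_a; dually, it gives   *)
(* a derivation of kE.                                                        *)
Lemma shift_derivation b x y : primitive_elt b ->
  shift b (x * y) = shift b x * y + x * shift b y.
Proof.
move=> bP; apply/lfunP => c; rewrite shiftE add_lfunE !measureM comulM linear_tlift.
rewrite -tliftDl; apply: eq_tlift => u v; rewrite [LHS]linear_tlift bP.
have tl (b1 b2 : B) : tlift (fun b1 b2 => tlift (fun b1 b2 => x b1 * y b2 : k^o)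
     (tensor (u * b1) (v * b2))) (tensor b1 b2) = x (u * b1) * y (v * b2).
  rewrite tlift_tensor ?tlift_measures // => [v'|u'] a c1 c2.
    by rewrite !tlift_measures mulrDr -scalerAr linearP mulrDl -scalerAl.
  by rewrite !tlift_measures mulrDr -scalerAr linearP mulrDr -scalerAr.
by rewrite linearD /= !tl !shiftE !mulr1.
Qed.

Lemma iter_shift b x n c : iter n (shift b) x c = x (c * b ^+ n).
Proof.
elim: n c => [|n IH] c; first by rewrite mulr1.
by rewrite iterS shiftE IH -mulrA -exprS.
Qed.

Lemma measureM_exp b x y n : primitive_elt b ->
  (x * y) (b ^+ n) = \sum_(i < n.+1) (x (b ^+ i) * y (b ^+ (n - i))) *+ 'C(n, i).
Proof.
move=> bP; have D := iter_derivation n (fun x y => shift_derivation x y bP) x y.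
have := congr1 (fun z : measures E => z 1) D.
rewrite /= iter_shift mul1r => ->; rewrite sum_lfunE.
apply: eq_bigr => i _; rewrite -scaler_nat scale_lfunE scaler_nat measureM1.
by rewrite !iter_shift !mul1r.
Qed.
End MeasureAlgebra.

Section PushMeasure.
Variables (k : fieldType) (E F : finGroupScheme k).
Variable pi : {lrmorphism coord_ring E -> coord_ring F}.
Hypothesis piP : closed_subgroup pi.

Lemma push_measureM x y :
  push_measure pi (x * y) = push_measure pi x * push_measure pi y.
Proof.
apply/lfunP => b; rewrite push_measureE !measureM piP.1 linear_tlift.
by apply: eq_tlift => b1 b2; rewrite /= tlift_measures !push_measureE.
Qed.

(* push_measure pi 1 is idempotent, and invertible by the antipode of E.      *)
Lemma push_measure1 : push_measure pi 1 = 1.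
Proof.
set e := push_measure pi 1.
have ee : e * e = e by rewrite -push_measureM mulr1.
pose e' : measures E := (e \o linfun (antipode E))%VF.
have e'E b : e' b = e (antipode E b) by rewrite [LHS]comp_lfunE (lfunE (antipode E)).
have eM b c : e (b * c) = e b * e c.
  by rewrite !push_measureE rmorphM !measure1E rmorphM.
suff ee' : e * e' = 1 by rewrite -[e]mulr1 -[in LHS]ee' mulrA ee ee'.
apply/lfunP => b; rewrite measureM measure1E.
transitivity (e (tlift (fun b1 b2 => b1 * antipode E b2) (comul E b))).
  by rewrite linear_tlift; apply: eq_tlift => b1 b2; rewrite /= eM e'E.
rewrite antipoder linearZ /= push_measureE rmorph1 measure11.
by rewrite /GRing.scale /= mulr1.
Qed.

Lemma push_measureX x n : push_measure pi (x ^+ n) = push_measure pi x ^+ n.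
Proof. by elim: n => [|n IH]; rewrite ?push_measure1 // !exprS push_measureM IH. Qed.
End PushMeasure.

Section Frobenius.
Variables (k : fieldType) (p : nat) (hp : p \in [pchar k]).
Variables (E : finGroupScheme k) (abE : abelian_scheme E).
Implicit Types (x y z : measures E).

Definition frob_trivial x := x ^+ p = (x 1 ^+ p) *: (1 : measures E).

Let p_gt0 : (0 < p)%N. Proof. exact: prime_gt0 (pcharf_prime hp). Qed.
Let hpA : p \in [pchar (measures E)]. Proof. by rewrite (pchar_lalg (measures E)). Qed.

Lemma frob_trivialD x y : frob_trivial x -> frob_trivial y -> frob_trivial (x + y).
Proof.
move=> xP yP; have := pFrobenius_autD_comm hpA (measuresC abE x y).
rewrite !pFrobenius_autE /frob_trivial => ->; rewrite xP yP -scalerDl.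
rewrite add_lfunE; congr (_ *: _).
have := pFrobenius_autD_comm hp (mulrC (x 1 : k) (y 1 : k)).
by rewrite !pFrobenius_autE.
Qed.

Lemma frob_trivialZ (c : k) x : frob_trivial x -> frob_trivial (c *: x).
Proof.
by move=> xP; rewrite /frob_trivial exprZn xP scalerA scale_lfunE -exprMn_comm //; exact: mulrC.
Qed.

Lemma frob_trivial_sum (I : Type) (r : seq I) (F : I -> measures E) :
  (forall i, frob_trivial (F i)) -> frob_trivial (\sum_(i <- r) F i).
Proof.
move=> FP; elim: r => [|i r IH]; last by rewrite big_cons; apply: frob_trivialD.
by rewrite big_nil /frob_trivial zero_lfunE !expr0n gtn_eqF // scale0r.
Qed.

Lemma frob_trivial1 : frob_trivial 1.
Proof. by rewrite /frob_trivial expr1n measure11 expr1n scale1r. Qed.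

Lemma frob_trivialM x y : frob_trivial x -> frob_trivial y -> frob_trivial (x * y).
Proof.
move=> xP yP; rewrite /frob_trivial exprMn_comm; last exact: measuresC.
rewrite xP yP -scalerAl mul1r scalerA measureM1 exprMn_comm //; exact: mulrC.
Qed.

Lemma frob_trivial_prodv (U V : {vspace measures E}) :
  (forall x, x \in U -> frob_trivial x) -> (forall x, x \in V -> frob_trivial x) ->
  forall x, x \in (U * V)%VS -> frob_trivial x.
Proof.
move=> UP VP x; rewrite unlock => xUV.
rewrite (coord_span xUV); apply: frob_trivial_sum => i; apply: frob_trivialZ.
have := mem_tnth i (allpairs_tuple *%R (vbasis U) (vbasis V)).
rewrite (tnth_nth 0) => /allpairsP[[u v] /= [uU vV ->]]; apply: frob_trivialM.
  exact/UP/vbasis_mem.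
exact/VP/vbasis_mem.
Qed.

Lemma frob_trivial_bigprodv n (W : 'I_n -> {vspace measures E}) :
  (forall i x, x \in W i -> frob_trivial x) ->
  forall x, x \in (\big[@prodv k (measures E)/1%VS]_(i < n) W i) -> frob_trivial x.
Proof.
move=> WP; elim/big_ind: _ => [x /vlineP[c ->]|U V UP VP|i _].
- exact/frob_trivialZ/frob_trivial1.
- exact: frob_trivial_prodv.
- exact: WP.
Qed.
End Frobenius.

Section ElementaryFrobenius.
Variables (k : fieldType) (p : nat) (hp : p \in [pchar k]).
Variables (E : finGroupScheme k) (abE : abelian_scheme E).

Let p_prime : prime p. Proof. exact: pcharf_prime hp. Qed.
Let p_gt0 : (0 < p)%N. Proof. exact: prime_gt0. Qed.

(* k[G_a(r)] has basis T^i for i < p^r, and the dual basis gamma_i of kG_a(r) *)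
(* is a truncated divided power algebra, so that gamma_i^p is a multiple of   *)
(* 'C(p i, i) = 0 for i > 0.                                                  *)
Lemma frob_trivial_Ga (F : finGroupScheme k) r
  (pi : {lrmorphism coord_ring E -> coord_ring F}) (piP : closed_subgroup pi) :
  is_Ga_kernel p r F -> forall x, frob_trivial p (push_measure pi x).
Proof.
case=> f [g fK gK] TP; set T := f 'qX in TP; pose q := (p ^ r)%N.
have q_gt0 : (0 < q)%N by rewrite expn_gt0 p_gt0.
have szq : size (mk_monic ('X^(p ^ r) : {poly k})) = q.+1.
  by rewrite mk_monic_Xn prednK // size_polyXn.
have glin : linear g.
  move=> a b c; apply: (can_inj fK); rewrite linearP.
  by transitivity (a *: b + c); [exact: gK|congr (_ *: _ + _); exact/esym/gK].
pose gam_fun i (b : coord_ring F) : k^o := (g b : {poly k})`_i.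
have gam_lin i : linear (gam_fun i).
  by move=> a b c; rewrite /gam_fun glin /= coefD coefZ.
pose gam_lin_i i := GRing.isLinear.Build k (coord_ring F) k^o *:%R (gam_fun i) (gam_lin i).
pose gamL i : {linear coord_ring F -> k^o} := HB.pack (gam_fun i) (gam_lin_i i).
pose gam i : measures F := linfun (gamL i).
have gamE i b : gam i b = (g b : {poly k})`_i by rewrite lfunE.
have XE n : f (in_qpoly _ 'X^n) = T ^+ n by rewrite -rmorphXn -rmorphXn.
have gamT i n : (n < q)%N -> gam i (T ^+ n) = (n == i)%:R.
  move=> nq; rewrite gamE -XE fK in_qpoly_small ?coefXn 1?eq_sym //.
  by rewrite szq size_polyXn ltnS.
have polE (P : {poly k}) : (size P <= q)%N ->
    f (in_qpoly _ P) = \sum_(i < q) P`_i *: T ^+ i.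
  move=> szP; have {1}-> : P = \sum_(i < q) P`_i *: 'X^i.
    rewrite -(poly_def q); apply/polyP => i; rewrite coef_poly; case: ltnP => // qi.
    exact: nth_default (leq_trans szP qi).
  by rewrite !linear_sum; apply: eq_bigr => i _; rewrite !linearZ /= XE.
have bE b : b = \sum_(i < q) (g b : {poly k})`_i *: T ^+ i.
  rewrite -polE; last by rewrite -ltnS -szq size_mk_monic.
  rewrite -[LHS]gK; congr (f _); exact/val_inj/esym/in_qpoly_small/size_mk_monic.
have ext (x y : measures F) : (forall n, (n < q)%N -> x (T ^+ n) = y (T ^+ n)) -> x = y.
  move=> xy; apply/lfunP => b; rewrite (bE b) !linear_sum.
  by apply: eq_bigr => i _; rewrite !linearZ /= xy.
have gamM a b : gam a * gam b = 'C(a + b, a)%:R *: gam (a + b)%N.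
  apply: ext => n nq; rewrite measureM_exp // scale_lfunE gamT //.
  have [an|an] := ltnP n a.
    rewrite big1 => [|i _]; last first.
      have ia : (i < a)%N by apply: leq_ltn_trans an; rewrite -ltnS.
      by rewrite gamT ?(ltn_eqF ia) ?mul0r ?mul0rn // (leq_ltn_trans _ nq) // -ltnS.
    rewrite ltn_eqF ?scaler0 //; exact: leq_trans an (leq_addr _ _).
  have an' : (a < n.+1)%N by rewrite ltnS.
  rewrite (bigD1 (Ordinal an')) //= big1 ?addr0 => [|i ia]; last first.
    rewrite gamT ?(leq_ltn_trans _ nq) // -1?ltnS //.
    have /negbTE-> : (i : nat) != a by [].
    by rewrite mul0r mul0rn.
  rewrite !gamT ?(leq_ltn_trans _ nq) ?leq_subr // eqxx mul1r.
  have -> : (n - a == b)%N = (n == a + b)%N by lia.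
  by case: eqP => [->|_]; rewrite ?mul0rn ?scaler0 // /GRing.scale /= mulr1.
have xE (x : measures F) : x = \sum_(i < q) x (T ^+ i) *: gam i.
  apply: ext => m mq; rewrite sum_lfunE (bigD1 (Ordinal mq)) //= big1 ?addr0.
    by rewrite scale_lfunE gamT // eqxx /GRing.scale /= mulr1.
  move=> i im; rewrite scale_lfunE gamT // eq_sym.
  by have /negbTE-> : (i : nat) != m by []; rewrite scaler0.
have gam0 : gam 0%N = 1.
  rewrite -[LHS]mulr1 [X in _ * X]xE mulr_sumr [RHS]xE; apply: eq_bigr => i _.
  by rewrite -scalerAr gamM bin0 scale1r.
have gamX i n : (0 < n)%N -> exists c, gam i ^+ n = c *: gam (i * n)%N.
  case: n => // n _; elim: n => [|n [c IH]]; first by exists 1; rewrite scale1r muln1.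
  exists (c * 'C(i + i * n.+1, i)%:R).
  by rewrite exprS IH -scalerAr gamM scalerA -mulnS.
have gamp i : (0 < i)%N -> gam i ^+ p = 0.
  move=> i0; have p2 := prime_gt1 p_prime.
  have p1 : (0 < p.-1)%N by rewrite -ltnS prednK.
  have [c cE] := gamX i _ p1; rewrite -(prednK p_gt0) exprS cE -scalerAr gamM.
  have -> : (i + i * p.-1 = p * i)%N by rewrite -mulnS prednK // mulnC.
  have : (p %| 'C(p * i, i))%N.
    have := mul_bin_diag (p * i) i.-1; rewrite prednK // => H.
    apply/dvdnP; exists 'C((p * i).-1, i.-1); apply/eqP.
    by rewrite -(eqn_pmul2l i0) -H [(_ * p)%N]mulnC mulnA [(p * i)%N]mulnC.
  by rewrite (dvdn_pcharf hp) => /eqP ->; rewrite scale0r scaler0.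
move=> x; rewrite [x]xE.
rewrite linear_sum; apply: (frob_trivial_sum hp abE) => i; rewrite linearZ.
apply: frob_trivialZ; case: i => -[|i] iq /=.
  by rewrite gam0 push_measure1 //; apply: frob_trivial1.
rewrite /frob_trivial -push_measureX // gamp // linear0 push_measureE rmorph1.
by rewrite -[1](expr0 T) gamT // expr0n gtn_eqF // scale0r.
Qed.

Lemma frob_trivial_Zp (F : finGroupScheme k)
  (pi : {lrmorphism coord_ring E -> coord_ring F}) (piP : closed_subgroup pi) :
  is_constant_Zp p F -> forall x, frob_trivial p (push_measure pi x).
Proof.
case=> f [[g fK gK] f1 fM fD]; set del := fun c : 'Z_p => f [ffun a => (a == c)%:R].
have glin : linear g.
  by move=> a b c; apply: (can_inj fK); rewrite linearP !gK.
pose e_fun c (b : coord_ring F) : k^o := g b c.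
have e_lin c : linear (e_fun c).
  by move=> a b d; rewrite /e_fun glin !ffunE.
pose e_lin_c c := GRing.isLinear.Build k (coord_ring F) k^o *:%R (e_fun c) (e_lin c).
pose eL c : {linear coord_ring F -> k^o} := HB.pack (e_fun c) (e_lin_c c).
pose e c : measures F := linfun (eL c).
have eE c h : e c (f h) = h c by rewrite lfunE /= /e_fun fK.
have ext (x y : measures F) : (forall h, x (f h) = y (f h)) -> x = y.
  by move=> xy; apply/lfunP => b; rewrite -[b]gK xy.
have mE (x y : measures F) h :
    (x * y) (f h) = \sum_a \sum_b h (a + b) *: (x (del a) * y (del b) : k^o).
  rewrite measureM fD linear_sum; apply: eq_bigr => a _.
  by rewrite linear_sum; apply: eq_bigr => b _; rewrite linearZ /= tlift_measures.
have edel c a : e c (del a) = (c == a)%:R by rewrite eE ffunE.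
have eM c d : e c * e d = e (c + d).
  apply: ext => h; rewrite mE (bigD1 c) //= [X in _ + X]big1 => [|a ac]; last first.
    by apply: big1 => b _; rewrite !edel [c == a]eq_sym (negbTE ac) mul0r scaler0.
  rewrite addr0 (bigD1 d) //= big1 ?addr0 => [|b bd].
    by rewrite !edel !eqxx mulr1 eE /GRing.scale /= mulr1.
  by rewrite !edel [d == b]eq_sym (negbTE bd) mulr0 scaler0.
have xE (x : measures F) : x = \sum_c x (del c) *: e c.
  apply: ext => h; have {1}-> : h = \sum_c h c *: [ffun a => (a == c)%:R].
    apply/ffunP => a; rewrite sum_ffunE (bigD1 a) //= big1 ?addr0 => [|b ba].
      by rewrite !ffunE eqxx /GRing.scale /= mulr1.
    by rewrite !ffunE eq_sym (negbTE ba) scaler0.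
  rewrite !linear_sum sum_lfunE; apply: eq_bigr => c _.
  by rewrite !linearZ scale_lfunE eE /GRing.scale /= mulrC.
have e0 : e 0 = 1.
  rewrite -[LHS]mulr1 [X in _ * X]xE mulr_sumr [RHS]xE; apply: eq_bigr => c _.
  by rewrite -scalerAr eM add0r.
have eX c n : e c ^+ n = e (c *+ n).
  by elim: n => [|n IH]; rewrite ?mulr0n ?e0 // exprS IH eM mulrS.
move=> x; rewrite [x]xE linear_sum; apply: (frob_trivial_sum hp abE) => c.
rewrite linearZ /=; apply: frob_trivialZ; rewrite /frob_trivial -push_measureX //.
rewrite eX -mulr_natr pchar_Zp ?prime_gt1 // mulr0 e0 push_measure1 //.
by rewrite push_measureE rmorph1 -f1 eE ffunE expr1n scale1r.
Qed.

End ElementaryFrobenius.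

Lemma elementary_frob_trivial (k : fieldType) (p : nat) (hp : p \in [pchar k])
  (E : finGroupScheme k) : elementary_abelian p E ->
  forall x : measures E, frob_trivial p x.
Proof.
case=> abE [n [F [pi [piP FP EP]]]] x; have : x \in fullv by rewrite memvf.
rewrite -EP; apply: (frob_trivial_bigprodv hp abE) => i _ /memv_imgP[y _ ->].
rewrite lfunE /=; case: (FP i) => [[r FGa]|FZp].
  exact: (frob_trivial_Ga hp abE (piP i) FGa y).
exact: (frob_trivial_Zp hp abE (piP i) FZp y).
Qed.

Section RadicalMeasures.
Variables (k : fieldType) (p : nat) (hp : p \in [pchar k]).
Variables (E : finGroupScheme k) (frobE : forall x : measures E, frob_trivial p x).

Lemma left_ideal_augmentation (m : {vspace measures E}) : (fullv * m <= m)%VS ->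
  m <> fullv -> forall x, x \in m -> x 1 = 0.
Proof.
move=> mI mf x xm; apply: contrapT => /eqP x1; apply: mf; apply/eqP.
have p_gt0 := prime_gt0 (pcharf_prime hp).
have m1 : 1 \in m.
  have := rpredZ (x 1 ^- p : k) (subvP mI _ (memv_mul (memvf (x ^+ p.-1)) xm)).
  by rewrite -exprSr prednK // frobE scalerA mulVf ?scale1r // expf_neq0.
rewrite eqEsubv subvf /=.
by apply/subvP => y _; rewrite -[y]mulr1 (subvP mI) // memv_mul ?memvf.
Qed.

Lemma mem_RadE x : (x \in Rad (measures E)) = (x 1 == 0).
Proof.
pose ev (y : measures E) : k^o := y 1.
have ev_lin : linear ev by move=> a y z; rewrite /ev add_lfunE scale_lfunE.
pose evm := GRing.isLinear.Build k (measures E) k^o *:%R ev ev_lin.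
pose evL : {linear measures E -> k^o} := HB.pack ev evm.
pose m := lker (linfun evL).
have memm y : (y \in m) = (y 1 == 0) by rewrite memv_ker lfunE.
have mI : (fullv * m <= m)%VS.
  by apply/prodvP => y z _; rewrite !memm measureM1 => /eqP->; rewrite mulr0.
have mf : m <> fullv.
  move=> mf; have := memvf (1 : measures E).
  by rewrite -mf memm measure11 oner_eq0.
have mM : maximal_left_ideal m.
  split=> // m' m'I mm'; have [->|/eqP m'f] := eqVneq m' fullv; first by right.
  left; apply/eqP; rewrite eqEsubv mm' andbT; apply/subvP => y ym'.
  by rewrite memm (left_ideal_augmentation m'I m'f ym').
apply/idP/idP => [/RadP/(_ _ mM)|x1]; first by rewrite memm.
apply/RadP => m' [m'I m'f m'M]; case: (m'M m mI) => [|<-|//].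
  by apply/subvP => y ym'; rewrite memm (left_ideal_augmentation m'I m'f ym').
by rewrite memm.
Qed.
End RadicalMeasures.

(** * Derivations and p-points *)

Lemma separating_functional (k : fieldType) (V : vectType k) (W : {vspace V}) u :
  u \notin W -> exists l : 'Hom(V, k^o), l u = 1 /\ forall w, w \in W -> l w = 0.
Proof.
move=> uW; pose w := u - projv W u.
have w0 : w != 0.
  apply: contra uW; rewrite subr_eq0 => /eqP ->; exact: memv_proj.
have [i wi] : exists i, coord (vbasis {:V}) i w != 0.
  apply: contrapT => H; move/eqP: w0; apply.
  rewrite (coord_vbasis (memvf w)) big1 // => i _.
  have /eqP-> : coord (vbasis {:V}) i w == 0 by apply: contrapT => /negP H'; apply: H; exists i.
  by rewrite scale0r.
pose lf (v : V) : k^o := coord (vbasis {:V}) i (v - projv W v) / coord (vbasis {:V}) i w.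
have lfl : linear lf.
  move=> a x y; rewrite /lf linearP opprD addrACA -scalerBr linearP mulrDl.
  by congr (_ + _); rewrite /GRing.scale /= mulrA.
pose lm := GRing.isLinear.Build k V k^o *:%R lf lfl.
pose l : {linear V -> k^o} := HB.pack lf lm.
exists (linfun l); split=> [|v vW]; first by rewrite lfunE /= /lf divff.
by rewrite lfunE /= /lf projv_id // subrr linear0 mul0r.
Qed.

Lemma hockey_stick n l : (\sum_(i < n) 'C(i, l) = 'C(n, l.+1))%N.
Proof.
elim: n => [|n IH]; first by rewrite big_ord0 bin0n.
by rewrite big_ord_recr /= IH binS addnC.
Qed.

Lemma prime_dvd_sum_ffact p l : prime p -> (l < p.-1)%N ->
  (p %| \sum_(i < p) i ^_ l)%N.
Proof.
move=> pp lp; have p0 := prime_gt0 pp.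
under eq_bigr do rewrite -bin_ffact.
rewrite -big_distrl /= hockey_stick dvdn_mulr // prime_dvd_bin //=.
by rewrite -[X in (_ < X)%N](prednK p0) ltnS.
Qed.

Lemma iter_derivation_exp (R : nzRingType) (D : {additive R -> R}) (u : R) :
  (forall x y, D (x * y) = D x * y + x * D y) -> D u = 1 ->
  forall l a, iter l D (u ^+ a) = u ^+ (a - l) *+ (a ^_ l).
Proof.
move=> DM Du; have D1 : D 1 = 0.
  by have := DM 1 1; rewrite !mulr1 mul1r => /eqP; rewrite -subr_eq0 opprD addrA subrr sub0r oppr_eq0 => /eqP.
have DX a : D (u ^+ a) = u ^+ a.-1 *+ a.
  elim: a => [|a IH]; first by rewrite D1 mulr0n.
  rewrite exprS DM Du mul1r IH /=; case: a {IH} => [|a]; first by rewrite mulr0n mulr0 addr0.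
  by rewrite /= mulrnAr -exprS -mulrS.
elim=> [|l IH] a; first by rewrite subn0 ffactn0.
rewrite iterS IH raddfMn /= DX -mulrnA subnS; congr (_ *+ _).
by rewrite ffactnSr mulnC.
Qed.

(* The Weyl algebra relation D u - u D = 1 turns a multiple of D^(p-1) into   *)
(* the averaging operator of Higman's criterion for k[u]/(u^p).               *)
Lemma higman_derivation (R : nzRingType) (D : {additive R -> R}) (u : R) p :
  p \in [pchar R] -> (forall x y, D (x * y) = D x * y + x * D y) -> D u = 1 ->
  forall x, \sum_(i < p) u ^+ i * iter p.-1 D (u ^+ (p.-1 - i) * x) = x *+ (p.-1)`!.
Proof.
move=> cp DM Du x; have pp := pcharf_prime cp; have p0 := prime_gt0 pp.
transitivity (\sum_(l < p.-1.+1) \sum_(i < p)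
    (u ^+ (p.-1 - l) * iter (p.-1 - l) D x) *+ ('C(p.-1, l) * i ^_ l)).
  rewrite exchange_big (reindex_inj rev_ord_inj) /=; apply: eq_bigr => i _.
  have ip : (i <= p.-1)%N by rewrite -ltnS prednK.
  have -> : (p - i.+1 = p.-1 - i)%N by lia.
  rewrite subKn // iter_derivation // mulr_sumr; apply: eq_bigr => l _.
  rewrite iter_derivation_exp // mulrnAr mulrnAl mulrnAr -mulrnA [in RHS]mulnC.
  have [li|li] := leqP l i; last by rewrite ffact_small // mul0n !mulr0n.
  by rewrite mulrA -exprD; congr (_ ^+ _ * _ *+ _); lia.
under eq_bigr do rewrite sumrMnr.
rewrite big_ord_recr /= big1 ?add0r => [|l _].
  rewrite subnn !expr0 mul1r /= -big_distrr /= binn mul1n.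
  congr (_ *+ _); rewrite -(prednK p0) big_ord_recr /= ffactnn big1 // => i _.
  exact: ffact_small.
have /dvdnP[c ->] : (p %| \sum_(i < p) 'C(p.-1, l) * i ^_ l)%N.
  by rewrite -big_distrr dvdn_mull // prime_dvd_sum_ffact.
by rewrite mulnC mulrnA (mulrn_pchar cp) mul0rn.
Qed.

Section PPoints.
Variables (k : fieldType) (p : nat) (hp : p \in [pchar k]).
Variables (E : finGroupScheme k) (abE : abelian_scheme E).
Hypothesis frobE : forall x : measures E, frob_trivial p x.
Local Notation A := (measures E).
Local Notation B := (coord_ring E).
Local Notation R := (truncated_poly k p).

Let p_prime : prime p. Proof. exact: pcharf_prime hp. Qed.
Let p_gt0 : (0 < p)%N. Proof. exact: prime_gt0. Qed.
Let p_gt1 : (1 < p)%N. Proof. exact: prime_gt1. Qed.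

Lemma Rad_nilpotent (u : A) : u \in Rad A -> u ^+ p = 0.
Proof. by rewrite (mem_RadE hp frobE) frobE => /eqP->; rewrite expr0n gtn_eqF // scale0r. Qed.

Lemma functional_eval (l : 'Hom(A, k^o)) : exists b : B, forall x : A, l x = x b.
Proof.
pose e := vbasis {:B}; pose c i : A := linfun (coord e i : B -> k^o).
exists (\sum_(i < \dim {:B}) l (c i) *: e`_i) => x.
have -> : x = \sum_(i < \dim {:B}) x (e`_i) *: c i.
  apply/lfunP => b; rewrite {1}(coord_vbasis (memvf b)) linear_sum sum_lfunE.
  by apply: eq_bigr => i _; rewrite linearZ scale_lfunE lfunE /= /GRing.scale /= mulrC.
rewrite linear_sum [RHS]sum_lfunE; apply: eq_bigr => i _.
rewrite linearZ scale_lfunE linear_sum /= (bigD1 i) //= big1 ?addr0 => [|j ji].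
  rewrite linearZ /= [in RHS]lfunE /= coord_free ?(basis_free (vbasisP _)) // eqxx.
  by rewrite /GRing.scale /= mulr1.
rewrite linearZ /= lfunE /= coord_free ?(basis_free (vbasisP _)) //.
by rewrite (negbTE ji) scaler0.
Qed.

Lemma primitive_of_measure (u : A) : u \in Rad A -> u \notin Rad2 E ->
  exists b, primitive_elt b /\ u b = 1.
Proof.
move=> uR uR2.
have R2 x : x \in Rad2 E -> x 1 = 0.
  move=> xR2; apply/eqP; rewrite -(mem_RadE hp frobE); apply: (subvP _ _ xR2).
  apply/prodvP => y z; rewrite !(mem_RadE hp frobE) measureM1 => /eqP-> _.
  by rewrite mul0r.
have uW : u \notin (Rad2 E + 1)%VS.
  apply: contra uR2 => /memv_addP[r rR2 [_ /vlineP[c ->]] uE].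
  suff c0 : c = 0 by rewrite uE c0 scale0r addr0.
  move: uR; rewrite (mem_RadE hp frobE) uE add_lfunE scale_lfunE measure11 R2 // add0r.
  by rewrite /GRing.scale /= mulr1 => /eqP.
have [l [lu lW]] := separating_functional uW.
have [b lb] := functional_eval l; exists b; split; last by rewrite -lb.
have l1 : l 1 = 0 by rewrite lW // (subvP (addvSr _ _)) ?memv_line.
have lM (x y : A) : l (x * y) = l x * y 1 + x 1 * l y.
  have decomp (z : A) : exists2 z', z' \in Rad A & z = z 1 *: (1 : A) + z'.
    exists (z - z 1 *: (1 : A)); last by rewrite addrC subrK.
    rewrite (mem_RadE hp frobE) add_lfunE opp_lfunE scale_lfunE measure11.
    by rewrite /GRing.scale /= mulr1 subrr.
  have [x' x'R xE] := decomp x; have [y' y'R yE] := decomp y.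
  have lx : l x = l x' by rewrite xE linearD linearZ /= l1 scaler0 add0r.
  have ly : l y = l y' by rewrite yE linearD linearZ /= l1 scaler0 add0r.
  have lxy : l (x' * y') = 0 by rewrite lW // (subvP (addvSl _ _)) // memv_mul.
  rewrite {1}xE {1}yE mulrDl !mulrDr -!scalerAl -!scalerAr !mul1r !mulr1.
  rewrite !linearD !linearZ /= l1 lxy lx ly !scaler0 add0r addr0.
  by rewrite addrC /GRing.scale /= [y 1 * _]mulrC.
apply/matrixP => i j.
pose e := vbasis {:B}; pose c i : A := linfun (coord e i : B -> k^o).
have cE s b' : c s b' = coord e s b' by rewrite lfunE.
have ev (t : tens B B) : tlift (fun b1 b2 => c i b1 * c j b2 : k^o) t = t i j.
  rewrite /tlift (bigD1 i) //= (bigD1 j) //= big1 ?addr0 => [|j' j'j]; last first.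
    by rewrite !cE !coord_free ?(basis_free (vbasisP _)) // (negbTE j'j) mulr0 scaler0.
  rewrite big1 ?addr0 => [|i' i'i]; last first.
    rewrite big1 // => j' _.
    by rewrite !cE !coord_free ?(basis_free (vbasisP _)) // (negbTE i'i) mul0r scaler0.
  by rewrite !cE !coord_free ?(basis_free (vbasisP _)) // !eqxx mulr1 /GRing.scale /= mulr1.
by rewrite -!ev linearD /= !tlift_measures -measureM -lb lM !lb.
Qed.

Lemma unit_derivation (u : A) : u \in Rad A -> u \notin Rad2 E ->
  exists D : {linear A -> A},
    (forall x y, D (x * y) = D x * y + x * D y) /\ D u = 1.
Proof.
move=> uR uR2; have [b [bP ub]] := primitive_of_measure uR uR2.
pose w := shift b u.
have w1 : w ^+ p = 1 by rewrite frobE shiftE mul1r ub expr1n scale1r.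
pose Df (x : A) : A := w ^+ p.-1 * shift b x.
have Dl : linear Df.
  by move=> a x y; rewrite /Df linearP mulrDr -scalerAr.
pose Dm := GRing.isLinear.Build k A A *:%R Df Dl.
pose D : {linear A -> A} := HB.pack Df Dm.
exists D; split=> [x y|]; last by rewrite /= /Df -exprSr prednK.
rewrite /= /Df (shift_derivation x y bP) mulrDr mulrA; congr (_ + _).
by rewrite mulrA [_ * x](measuresC abE) mulrA.
Qed.

Section Evaluation.
Variables (u : A) (up : u ^+ p = 0).

Definition eval_trunc (q : R) : A := horner_alg u (q : {poly k}).

Let mkX : mk_monic ('X^p : {poly k}) = 'X^p.
Proof. by rewrite mk_monic_Xn prednK. Qed.

Lemma horner_alg_mod (P : {poly k}) :
  horner_alg u (Pdiv.CommonRing.rmodp P (mk_monic 'X^p)) = horner_alg u P.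
Proof.
rewrite mkX [in RHS](Pdiv.RingMonic.rdivp_eq (monicXn k p) P) rmorphD rmorphM rmorphXn /=.
by rewrite horner_algX up mulr0 add0r.
Qed.

Fact eval_trunc_is_linear : linear eval_trunc.
Proof. by move=> a x y; rewrite /eval_trunc poly_of_qpolyD poly_of_qpolyZ linearP /= mulr_algl. Qed.

Fact eval_trunc_is_monoid_morphism : monoid_morphism eval_trunc.
Proof.
split=> [|x y]; first by rewrite /eval_trunc /= rmorph1.
by rewrite /eval_trunc poly_of_qpolyM horner_alg_mod rmorphM.
Qed.

HB.instance Definition _ :=
  GRing.isLinear.Build k R A *:%R eval_trunc eval_trunc_is_linear.
HB.instance Definition _ :=
  GRing.isMonoidMorphism.Build R A eval_trunc eval_trunc_is_monoid_morphism.

Definition ppoint_of : {lrmorphism R -> A} := eval_trunc.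

Lemma ppoint_ofX : ppoint_of 'qX = u.
Proof. by rewrite /= /eval_trunc /= horner_alg_mod horner_algX. Qed.
End Evaluation.

Lemma trunc_polyE (a : R) : a = \sum_(i < p) (a : {poly k})`_i *: 'qX ^+ i.
Proof.
have sza : (size (a : {poly k}) <= p)%N.
  by rewrite -ltnS (leq_trans (size_mk_monic a)) // mk_monic_Xn prednK // size_polyXn.
rewrite [LHS](_ : _ = in_qpoly _ (a : {poly k})); last first.
  exact/val_inj/esym/in_qpoly_small/size_mk_monic.
have {1}-> : (a : {poly k}) = \sum_(i < p) (a : {poly k})`_i *: 'X^i.
  rewrite -(poly_def p); apply/polyP => i; rewrite coef_poly; case: ltnP => // pi.
  exact: nth_default (leq_trans sza pi).
by rewrite linear_sum; apply: eq_bigr => i _; rewrite linearZ rmorphXn.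
Qed.

Lemma qX_exp_p : ('qX : R) ^+ p = 0.
Proof.
rewrite /qpolyX -rmorphXn; apply: val_inj => /=.
by rewrite mk_monic_Xn prednK // Pdiv.RingMonic.rmodpp ?monicXn.
Qed.

Lemma ppoint_derivation (alpha : {lrmorphism R -> A}) (D : {linear A -> A}) :
  (forall x y, D (x * y) = D x * y + x * D y) -> D (alpha 'qX) = 1 ->
  is_ppoint alpha.
Proof.
move=> DM Du N Q g f gsurj; set u := alpha 'qX in Du; pose t : R := 'qX.
pose P := restrict_scalars alpha.
have scaleP (a : R) (x : A) : a *: (x : P) = (alpha a * x : A) by [].
have scaleC (c : k) (x : A) : (c%:A : R) *: (x : P) = (c *: x : A).
  by rewrite scaleP linearZ rmorph1 mulr_algl.
have up : u ^+ p = 0 by rewrite -rmorphXn qX_exp_p rmorph0.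
pose c : k := (p.-1)`!%:R.
have c0 : c != 0.
  rewrite -(dvdn_pcharf hp).
  suff nd m : (m < p)%N -> ~~ (p %| m`!)%N by rewrite nd // prednK.
  elim: m => [|m IH] mp; first by rewrite fact0 dvdn1 gtn_eqF.
  by rewrite factS Euclid_dvdM // negb_or gtnNdvd // IH // ltnW.
pose phi (x : A) : A := c^-1 *: iter p.-1 D x.
have phiL : linear phi.
  move=> a x y; rewrite /phi.
  have -> m : iter m D (a *: x + y) = a *: iter m D x + iter m D y.
    by elim: m => //= m ->; rewrite linearP.
  by rewrite scalerDr !scalerA mulrC.
have hig (x : A) : \sum_(i < p) u ^+ i * phi (u ^+ (p.-1 - i) * x) = x.
  under eq_bigr do rewrite /phi -scalerAr.
  rewrite -scaler_sumr (higman_derivation _ DM Du); last by rewrite (pchar_lalg A).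
  by rewrite -scaler_nat scalerA mulVf ?scale1r.
have [n nE] : exists n : 'I_(\dim {:A}) -> N, forall i, g (n i) = f (vbasis {:A})`_i.
  by exists (fun i => sval (cid (gsurj (f (vbasis {:A})`_i)))) => i; case: cid.
pose s (x : A) : N := \sum_i ((coord (vbasis {:A}) i x)%:A : R) *: n i.
have sL (a : k) (x y : A) : s (a *: x + y) = (a%:A : R) *: s x + s y.
  rewrite /s scaler_sumr -big_split; apply: eq_bigr => i _ /=.
  by rewrite linearP scalerDl scalerDl scalerA -[in RHS]scalerAl mul1r scalerA.
have gs (x : A) : g (s x) = f x.
  rewrite linear_sum [in RHS](coord_vbasis (memvf x)).
  have fD (I : Type) (r : seq I) (F : I -> A) : f (\sum_(i <- r) F i) = \sum_(i <- r) f (F i).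
    exact: (raddf_sum f).
  by rewrite fD; apply: eq_bigr => i _; rewrite linearZ /= nE -scaleC linearZ.
pose h (x : P) : N := \sum_(i < p) t ^+ i *: s (phi (u ^+ (p.-1 - i) * (x : A))).
have hL (a : k) (x y : A) : h (a *: x + y) = (a%:A : R) *: h x + h y.
  rewrite /h scaler_sumr -big_split; apply: eq_bigr => i _ /=.
  rewrite mulrDr -scalerAr phiL sL scalerDr !scalerA; congr (_ *: _ + _).
  by rewrite mulrC.
have s0 : s 0 = 0.
  by have := sL (-1) 0 0; rewrite scaler0 addr0 !scaleN1r addNr.
have phi0 : phi 0 = 0 by have := phiL (-1) 0 0; rewrite scaler0 addr0 => ->; rewrite scaleN1r addNr.
have h0 : h 0 = 0 by rewrite /h big1 // => i _; rewrite mulr0 phi0 s0 scaler0.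
have ht (x : A) : h (u * x) = t *: h x.
  pose G i := t ^+ i *: s (phi (u ^+ (p - i) * x)).
  transitivity (\sum_(i < p) G i).
    apply: eq_bigr => i _; rewrite /G.
    suff -> : u ^+ (p - i) * x = u ^+ (p.-1 - i) * (u * x) by [].
    by rewrite mulrA -exprSr; congr (_ ^+ _ * _); have := ltn_ord i; lia.
  transitivity (\sum_(i < p) G i.+1).
    have : \sum_(i < p.+1) G i = \sum_(i < p.+1) G i by [].
    rewrite [LHS]big_ord_recr [RHS]big_ord_recl /= {2}/G qX_exp_p scale0r addr0 => ->.
    by rewrite {1}/G subn0 up mul0r phi0 s0 scaler0 add0r.
  rewrite /h scaler_sumr; apply: eq_bigr => i _; rewrite /G scalerA -exprS.
  by have -> : (p - i.+1 = p.-1 - i)%N by lia.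
have htn i (x : A) : h (u ^+ i * x) = t ^+ i *: h x.
  elim: i => [|i IH]; first by rewrite mul1r scale1r.
  by rewrite exprS -mulrA ht IH scalerA -exprS.
have hlin : linear (h : P -> N).
  move=> a x y; have hD (x1 x2 : A) : h (x1 + x2) = h x1 + h x2.
    by rewrite -[x1]scale1r hL !scale1r.
  have hZ (b : k) (x1 : A) : h (b *: x1) = (b%:A : R) *: h x1.
    by rewrite -[b *: x1]addr0 hL h0 addr0.
  have hS (I : Type) (r : seq I) (F : I -> A) : h (\sum_(i <- r) F i) = \sum_(i <- r) h (F i).
    by elim: r => [|i r IH]; rewrite ?big_nil ?big_cons ?h0 // hD IH.
  rewrite [LHS]hD; congr (_ + _); rewrite scaleP [a in LHS]trunc_polyE linear_sum mulr_suml.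
  rewrite hS [a in RHS]trunc_polyE scaler_suml; apply: eq_bigr => i _.
  by rewrite linearZ rmorphXn -scalerAl hZ htn scalerA -scalerAl mul1r.
pose hm := GRing.isLinear.Build R P N *:%R (h : P -> N) hlin.
pose H : {linear P -> N} := HB.pack (h : P -> N) hm.
exists H => x; rewrite /= /h linear_sum -[in RHS](hig x).
have fD (I : Type) (r : seq I) (F : I -> A) : f (\sum_(i <- r) F i) = \sum_(i <- r) f (F i).
  exact: (raddf_sum f).
rewrite fD; apply: eq_bigr => i _; rewrite linearZ /= gs -linearZ.
by rewrite scaleP rmorphXn.
Qed.

Lemma exists_ppoint (u : A) : u \in Rad A -> u \notin Rad2 E ->
  exists alpha : {lrmorphism R -> A}, is_ppoint alpha /\ alpha 'qX = u.
Proof.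
move=> uR uR2; have [D [DM Du]] := unit_derivation uR uR2.
have aX := ppoint_ofX (Rad_nilpotent uR).
by exists (ppoint_of (Rad_nilpotent uR)); split=> //; apply: (ppoint_derivation DM); rewrite aX.
Qed.

Lemma constant_jrankE (M : fdModule A) j : constant_jrank p M j ->
  forall u, u \in Rad A -> u \notin Rad2 E ->
  \dim (limg (act_pow M u j)) = jrank p M j.
Proof.
move=> hM u uR uR2; have [alpha [aP aX]] := exists_ppoint uR uR2.
by rewrite -(hM alpha aP) /ppoint_rank aX.
Qed.
End PPoints.

(** * Polynomial functions on subspaces *)

Section MpolyFacts.
Variables (k : fieldType) (n : nat).
Implicit Types (f g h : {mpoly k[n]}).

Lemma mcoeff_pihomog d f m : (pihomog mdeg d f)@_m = if mdeg m == d then f@_m else 0.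
Proof.
have [md|md] := eqVneq (mdeg m) d; last exact: dhomog_nemf_coeff (pihomogP _ _ _) md.
rewrite -[in RHS](subrK (pihomog mdeg d f) f) mcoeffD.
suff -> : (f - pihomog mdeg d f)@_m = 0 by rewrite add0r.
have fE := pihomog_partitionE (leqnn (msize f)).
have [fd|fd] := ltnP d (msize f); last first.
  have -> : pihomog mdeg d f = 0.
    rewrite pihomogE big_seq_cond big1 // => m' /andP[m'f /eqP m'd].
    by have := msize_mdeg_lt m'f; rewrite ltnNge m'd fd.
  by rewrite subr0 memN_msupp_eq0 // msize_mdeg_ge // md.
rewrite [X in X - _]fE (bigD1 (Ordinal fd)) //= addrC addrK raddf_sum big1 //= => i id.
suff : mdeg m != i by exact: dhomog_nemf_coeff (pihomogP _ _ _).
by rewrite md eq_sym; move: id; rewrite -val_eqE.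
Qed.

Lemma msize_pihomog d f : (msize (pihomog mdeg d f) <= msize f)%N.
Proof.
rewrite [X in (X <= _)%N]msizeE; apply/bigmax_leqP_seq => m mf _; apply: msize_mdeg_lt.
by move: mf; rewrite !mcoeff_msupp mcoeff_pihomog; case: ifP => // _ /eqP.
Qed.

Lemma pihomogM d e f g : g \is e.-homog ->
  pihomog mdeg (d + e) (f * g) = pihomog mdeg d f * g.
Proof.
move=> ge; have fE := pihomog_partitionE (leqnn (msize f)).
have homM i : pihomog mdeg i f * g \is (i + e).-homog by rewrite dhomogM ?pihomogP.
rewrite [in LHS]fE mulr_suml raddf_sum /=.
have ne i : i != d -> pihomog mdeg (d + e) (pihomog mdeg i f * g) = 0.
  by move=> id; apply: pihomog_ne0 (homM i); rewrite eqn_add2r.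
have [fd|fd] := ltnP d (msize f).
  rewrite (bigD1 (Ordinal fd)) //= big1 ?addr0 => [|i id]; last by apply: ne.
  exact: pihomog_dE.
rewrite big1 => [|i _]; last first.
  by apply: ne; rewrite ltn_eqF // (leq_trans (ltn_ord i)).
have -> : pihomog mdeg d f = 0; last by rewrite mul0r.
rewrite pihomogE big_seq_cond big1 // => m' /andP[m'f /eqP m'd].
by have := msize_mdeg_lt m'f; rewrite ltnNge m'd fd.
Qed.

Lemma pihomog_exists f : f != 0 -> exists d, pihomog mdeg d f != 0.
Proof.
move=> f0; apply: contrapT => H; move/eqP: f0; apply.
rewrite [f](pihomog_partitionE (leqnn (msize f))) big1 // => i _.
by apply/eqP; apply: contrapT => /negP Hi; apply: H; exists i.
Qed.

Lemma dhomog_big_prod (m d : nat) (F : 'I_m -> {mpoly k[n]}) :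
  (forall i, F i \is d.-homog) -> \prod_i F i \is (m * d).-homog.
Proof.
elim: m F => [|m IH] F FP; first by rewrite big_ord0 dhomog1.
by rewrite big_ord_recr mulSn addnC dhomogM // IH.
Qed.

Lemma dhomog_det (m d : nat) (N : 'M[{mpoly k[n]}]_m) :
  (forall i j, N i j \is d.-homog) -> \det N \is (m * d).-homog.
Proof.
move=> NP; apply: rpred_sum => s _; rewrite rpredMsign.
exact: dhomog_big_prod.
Qed.

Lemma dhomog_comp (m d : nat) (lq : m.-tuple {mpoly k[n]}) (f : {mpoly k[m]}) :
  (forall i, tnth lq i \is 1.-homog) -> f \is d.-homog -> f \mPo lq \is d.-homog.
Proof.
move=> lqP /dhomogP fd; rewrite comp_mpolyE big_seq; apply: rpred_sum => s sf.
apply: rpredZ; have <- : mdeg s = d := fd _ sf; rewrite mdegE.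
elim/big_rec2: _ => [|i d' q _ IH]; first exact: dhomog1.
by apply: dhomogM => //; have := dhomogMn (s i) (lqP i); rewrite mul1n.
Qed.

Lemma msize_le_mul f g : f != 0 -> (msize (f * g) <= msize f)%N -> g != 0 ->
  exists2 c : k, c != 0 & g = c%:MP.
Proof.
move=> f0 le g0; apply/msize_poly1P; move: le; rewrite msizeM //.
move: f0 g0; rewrite -!msize_poly_eq0; case: (msize f) (msize g) => // a [|[|b]] //= _ _.
by rewrite !addnS ltnS ltnNge leq_addr.
Qed.

Lemma mpoly_unitC h : h \is a GRing.unit -> exists2 c : k, c != 0 & h = c%:MP.
Proof.
rewrite unfold_in => /andP[/eqP hE h0]; exists h@_0 => //.
by move: h0; rewrite unitfE.
Qed.

Lemma mpolyC_unit (c : k) : c != 0 -> (c%:MP : {mpoly k[n]}) \is a GRing.unit.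
Proof.
move=> c0; apply/unitrPr; exists (c^-1)%:MP.
by rewrite -mpolyCM divff.
Qed.
End MpolyFacts.

Section Density.
Variable k : closedFieldType.

Lemma poly_mpoly_eval n (P : {poly {mpoly k[n]}}) (v : 'I_n.+1 -> k) :
  (poly_mpoly P).@[v] =
  (map_poly (meval (fun i => v (widen_ord (leqnSn n) i))) P).[v ord_max].
Proof.
have wE q : (mwiden q).@[v] = q.@[fun i => v (widen_ord (leqnSn n) i)].
  elim/mpolyind: q => [|c m q _ _ IH]; first by rewrite mwiden0 !meval0.
  rewrite mwidenD !mevalD IH mwidenZ !mevalZ mwidenX !mevalX; congr (_ * _ + _).
  rewrite big_ord_recr /= mnmwiden_ordmax expr0 mulr1.
  by apply: eq_bigr => i _; rewrite mnmwiden_widen.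
elim/poly_ind: P => [|P c IH].
  by rewrite -polyC0 poly_mpolyC mwiden0 meval0 map_polyC /= meval0 hornerC.
rewrite poly_mpolyD poly_mpolyM poly_mpolyC poly_mpolyX mevalD mevalM IH wE mevalXU.
by rewrite rmorphD rmorphM /= map_polyX map_polyC hornerD hornerM hornerX hornerC.
Qed.

Lemma mpoly_eval_eq0 n (h : {mpoly k[n]}) : (forall v, h.@[v] = 0) -> h = 0.
Proof.
elim: n h => [|n IH] h hv.
  by rewrite -[h](mpoly0K (fun=> 0)) hv mpolyC0.
suff H (P : {poly {mpoly k[n]}}) : (forall v, (poly_mpoly P).@[v] = 0) -> P = 0.
  by rewrite -[h]muniK (H (muni h)) ?muniK // -polyC0 poly_mpolyC mwiden0.
move=> Pv; apply/polyP => i; rewrite coef0; apply: IH => v.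
pose Q := map_poly (meval v) P; suff Q0 : Q = 0 by rewrite -coef_map -/Q Q0 coef0.
apply/eqP; apply: contrapT => /negP/closed_nonrootP[x /negP]; apply; apply/eqP.
pose w (i : 'I_n.+1) := if unlift ord_max i is Some j then v j else x.
rewrite -(Pv w) poly_mpoly_eval /w unlift_none; congr (_.[_]).
apply: eq_map_poly => q; apply: meval_eq => l.
have -> : widen_ord (leqnSn n) l = lift ord_max l.
  by apply: val_inj; rewrite /= /bump leqNgt ltn_ord.
by rewrite liftK.
Qed.

Variables (V : vectType k) (W : {vspace V}).

Lemma hcoordK (c : 'I_(\dim W) -> k) : hcoord (W := W) (\sum_i c i *: (vbasis W)`_i) =1 c.
Proof. by move=> i; rewrite /hcoord coord_sum_free // (basis_free (vbasisP W)). Qed.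

Lemma mem_sum_vbasis (c : 'I_(\dim W) -> k) : \sum_i c i *: (vbasis W)`_i \in W.
Proof. by apply: memv_suml => i _; rewrite memvZ // vbasis_mem // mem_nth ?size_tuple. Qed.

Lemma mpoly_dense (W' : {vspace V}) (h : {mpoly k[\dim W]}) :
  (exists2 u, u \in W & u \notin W') ->
  (forall u, u \in W -> u \notin W' -> h.@[hcoord u] = 0) -> h = 0.
Proof.
case=> u0 u0W u0W' hz; have [l [lu lW']] := separating_functional u0W'.
pose L : {mpoly k[\dim W]} := \sum_(i < \dim W) (l ((vbasis W)`_i) : k) *: 'X_i.
have LE u : u \in W -> L.@[hcoord u] = l u.
  move=> uW; rewrite raddf_sum /= [in RHS](coord_vbasis uW) linear_sum.
  by apply: eq_bigr => i _; rewrite mevalZ mevalXU linearZ /= mulrC.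
have L0 : L != 0.
  by apply/eqP => L0; have := LE _ u0W; rewrite L0 meval0 lu => /eqP; rewrite eq_sym oner_eq0.
suff /eqP : h * L = 0 by rewrite mulf_eq0 (negbTE L0) orbF => /eqP.
apply: mpoly_eval_eq0 => v; rewrite -(meval_eq _ (hcoordK v)); set u := \sum_(i < _) _.
have uW : u \in W by exact: mem_sum_vbasis.
rewrite mevalM LE //; have [uW'|uW'] := boolP (u \in W').
  by rewrite lW' // mulr0.
by rewrite hz // mul0r.
Qed.
End Density.

(** * Images and minors *)

Section Wedge.
Variables (k : fieldType) (M : vectType k).
Local Notation e := (vbasis {:M}).

Lemma det_reindex (R : comNzRingType) n d m (nd : n = d)
  (f : 'I_d -> 'I_m) (g : 'I_n -> 'I_m) (F : nat -> 'I_m -> R) :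
  injective g -> (forall i, exists j, g i = f j) ->
  \det (\matrix_(a < n, b < n) F a (g b)) = 0 ->
  \det (\matrix_(a < d, b < d) F a (f b)) = 0.
Proof.
case: d / nd f => f ginj gf gz.
have [s sE] : exists s : 'I_n -> 'I_n, forall i, g i = f (s i).
  by exists (fun i => sval (cid (gf i))) => i; case: cid.
have sinj : injective s by move=> i j sij; apply: ginj; rewrite !sE sij.
have colE : (\matrix_(a < n, b < n) F a (g b)) =
    (\matrix_(a < n, b < n) F a (f b)) *m perm_mx (perm sinj)^-1.
  by rewrite -col_permE; apply/matrixP => a b; rewrite !mxE permE sE.
move: gz; rewrite colE det_mulmx det_perm mulrC.
by move=> z; rewrite -[LHS](signrMK (perm sinj)^-1%g) z mulr0.
Qed.

Lemma wedge_lincomb d (X : d.-tuple M) (T : 'M[k]_d) (y : seq M) :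
  (forall a : 'I_d, y`_a = \sum_b T a b *: X`_b) ->
  wedge d y = \det T *: wedge d X.
Proof.
move=> yE; apply/ffunP => S; rewrite !ffunE.
case: S => S /= eS; move: (eqP eS) X T yE => eS'; move: eS; case: d / eS' => _ X T yE.
rewrite /GRing.scale /= -det_mulmx; congr (\det _); apply/matrixP => a b.
rewrite !mxE yE linear_sum; apply: eq_bigr => c _.
by rewrite linearZ !mxE.
Qed.

Lemma wedge_free_neq0 d (X : d.-tuple M) : free X -> wedge d X != 0.
Proof.
move=> fX; pose N : 'M[k]_(d, \dim {:M}) := \matrix_(a, b) coord e b X`_a.
have Nfree : row_full N^T.
  rewrite /row_full mxrank_tr -/(row_free N) -kermx_eq0; apply/eqP/row_matrixP => i.
  rewrite row0; set v := row i _; have vN : v *m N = 0.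
    by rewrite /v -row_mul mulmx_ker row0.
  have vX : \sum_a v 0 a *: X`_a = 0.
    rewrite [LHS](coord_vbasis (memvf _)) big1 // => b _.
    have := congr1 (fun A : 'rV_(\dim {:M}) => A 0 b) vN.
    rewrite [LHS]mxE [RHS]mxE linear_sum => vb.
    have -> : \sum_(i0 < d) coord e b (v 0 i0 *: X`_i0) = 0.
      by rewrite -[RHS]vb; apply: eq_bigr => a _; rewrite linearZ /= [N a b]mxE.
    by rewrite scale0r.
  by apply/rowP => a; rewrite [RHS]mxE; move/freeP: fX => /(_ (fun a => v 0 a) vX a).
pose f := fullrankfun Nfree; have finj : injective f by exact: fullrankfun_inj.
pose S := [set f i | i : 'I_d].
have cS : #|S| == d by rewrite card_imset // card_ord.
apply/eqP => /ffunP/(_ (exist _ S cS)); rewrite !ffunE /= => dz.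
have := det_reindex (eqP cS) (f := f) (F := fun a b => coord e b X`_a)
  (@enum_val_inj _ _) _ dz.
have im (i : 'I_#|S|) : exists j, enum_val i = f j.
  by have /imsetP[j _ ->] := enum_valP i; exists j.
move=> /(_ im) /eqP; apply/negP; rewrite -unitfE -unitmxE.
rewrite -unitmx_tr -row_full_unit.
have -> : (\matrix_(a < d, b < d) coord e (f b) X`_a)^T = rowsub f N^T.
  by apply/matrixP => a b; rewrite !mxE.
exact: fullrowsub_full.
Qed.

Lemma wedge_vbasis d (W : {vspace M}) : \dim W = d ->
  wedge d (vbasis W) != 0 /\
  forall y : seq M, (forall a, (a < d)%N -> y`_a \in W) ->
    exists c : k, wedge d y = c *: wedge d (vbasis W).
Proof.
move=> dW; case: d / dW; split; first by apply: wedge_free_neq0; exact: basis_free (vbasisP W).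
move=> y yW; exists (\det (\matrix_(a < \dim W, b < \dim W) coord (vbasis W) b y`_a)).
apply: wedge_lincomb => a; rewrite {1}(coord_vbasis (yW a (ltn_ord a))).
by apply: eq_bigr => b _; rewrite mxE.
Qed.
End Wedge.

Section Minors.
Variables (k : fieldType) (A : falgType k) (M : fdModule A) (W : {vspace A}).
Local Notation e := (vbasis {:M}).

Fixpoint pow_coord (y : M) (i : nat) (b : 'I_(\dim {:M})) : {mpoly k[\dim W]} :=
  if i is i'.+1 then
    \sum_(c < \dim {:M}) \sum_(l < \dim W)
      coord e b (act M (vbasis W)`_l e`_c) *: ('X_l * pow_coord y i' c)
  else (coord e b y)%:MP.

Lemma pow_coord_homog y i b : pow_coord y i b \is i.-homog.
Proof.
elim: i b => [|i IH] b /=.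
  by rewrite -[_%:MP]mulr1 mul_mpolyC rpredZ // dhomog1.
apply: rpred_sum => c _; apply: rpred_sum => l _; apply: rpredZ.
by rewrite -add1n dhomogM // dhomogX; apply/eqP; exact: mdeg1.
Qed.

Lemma act_powS u i : act_pow M u i.+1 = (act M u \o act_pow M u i)%VF.
Proof. by []. Qed.

Lemma pow_coord_eval u y i b : u \in W ->
  (pow_coord y i b).@[hcoord u] = coord e b (act_pow M u i y).
Proof.
move=> uW; elim: i b => [|i IH] b; first by rewrite /= mevalC id_lfunE.
rewrite act_powS comp_lfunE /= raddf_sum /=.
rewrite [in RHS](coord_vbasis (memvf (act_pow M u i y))) linear_sum linear_sum.
apply: eq_bigr => c _; rewrite raddf_sum /= {2}(coord_vbasis uW) linear_sum.
rewrite sum_lfunE linear_sum; apply: eq_bigr => l _.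
have actZ (a : k) w : act M (a *: w) = a *: act M w by exact: linearZ.
rewrite mevalZ mevalM mevalXU IH actZ scale_lfunE !linearZ /=.
by rewrite /hcoord /GRing.scale /=; ring.
Qed.

Definition minor (d j : nat) (x : seq M) (S : dsubset M d) : {mpoly k[\dim W]} :=
  \det (\matrix_(a < #|val S|, b < #|val S|) pow_coord x`_a j (enum_val b)).

Lemma minor_homog d j x (S : dsubset M d) : minor j x S \is (d * j).-homog.
Proof.
have -> : (d * j = #|val S| * j)%N by rewrite (eqP (valP S)).
by apply: dhomog_det => a b; rewrite mxE pow_coord_homog.
Qed.

Lemma minor_eval d j x (S : dsubset M d) u : u \in W ->
  (minor j x S).@[hcoord u] = wedge d [seq act_pow M u j y | y <- x] S.
Proof.
move=> uW; rewrite ffunE -(det_map_mx (meval (hcoord u))); congr (\det _).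
apply/matrixP => a b; rewrite !mxE /= pow_coord_eval //; congr (coord _ _ _).
have [ax|ax] := ltnP a (size x); first by rewrite (nth_map 0).
by rewrite !nth_default ?size_map ?linear0.
Qed.
End Minors.

Lemma vline_scale (k : fieldType) (V : vectType k) (c : k) (v : V) :
  c != 0 -> <[c *: v]>%VS = <[v]>%VS.
Proof.
move=> c0; apply/eqP; rewrite eqEsubv -!memvE memvZ ?memv_line //=.
by apply/vlineP; exists c^-1; rewrite scalerA mulVf ?scale1r.
Qed.

Section ImageMorphism.
Variables (k : closedFieldType) (A : falgType k) (M : fdModule A) (W W' : {vspace A}).
Variables (j d : nat).
Hypothesis rankW : forall u, u \in W -> u \notin W' -> \dim (limg (act_pow M u j)) = d.

Local Notation im u := (limg (act_pow M u j)).

Lemma minor_parallel (x y : seq M) :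
  (exists2 u, u \in W & u \notin W') ->
  parallel (fun S : dsubset M d => minor W j x S) (fun S => minor W j y S).
Proof.
move=> U0 S T; apply/eqP; rewrite -subr_eq0; apply/eqP; apply: (mpoly_dense U0).
move=> u uW uW'; rewrite mevalB !mevalM !minor_eval //.
have [_ imP] := wedge_vbasis (rankW uW uW').
have imx z a : [seq act_pow M u j v | v <- z]`_a \in im u.
  have [az|az] := ltnP a (size z); last by rewrite nth_default ?size_map ?mem0v.
  by rewrite (nth_map 0) // memv_img ?memvf.
have [c ->] := imP _ (fun a _ => imx x a); have [c' ->] := imP _ (fun a _ => imx y a).
by rewrite !ffunE /GRing.scale /=; ring.
Qed.

(* Up to a common factor, the Pluecker coordinates of the image are the       *)
(* minors of u_M^j in any d columns on which these do not all vanish.         *)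
Lemma image_homogeneous : exists (f : dsubset M d -> {mpoly k[\dim W]}) (c : nat),
  (forall S, f S \is c.-homog) /\
  forall u, u \in W -> u \notin W' ->
    heval f u != 0 /\ pluecker d (im u) = <[heval f u]>%VS.
Proof.
have [U0|U0] := pselect (exists2 u, u \in W & u \notin W'); last first.
  exists (fun=> 0), 0%N; split=> [S|u uW uW']; first exact: dhomog0.
  by case: U0; exists u.
have lift u : exists x : seq M, [seq act_pow M u j y | y <- x] = vbasis (im u).
  have [g gE] : exists g : M -> M, forall v, v \in im u -> act_pow M u j (g v) = v.
    exists (fun v => (act_pow M u j)^-1%VF v) => v vi; exact: limg_lfunVK.
  exists [seq g v | v <- vbasis (im u)]; rewrite -map_comp -[RHS]map_id.
  by apply/eq_in_map => v /vbasis_mem vi /=; rewrite gE.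
have mE u x S : u \in W -> [seq act_pow M u j y | y <- x] = vbasis (im u) ->
    (minor W j x S).@[hcoord u] = wedge d (vbasis (im u)) S.
  by move=> uW xE; rewrite minor_eval // xE.
have [u0 u0W u0W'] := U0; have [x0 x0E] := lift u0.
pose P (S : dsubset M d) := minor W j x0 S.
have [S0 PS0] : exists S, P S != 0.
  apply: contrapT => H; have [/eqP w0 _] := wedge_vbasis (rankW u0W u0W'); apply: w0.
  apply/ffunP => S; rewrite -(mE u0 x0) // [RHS]ffunE.
  suff /eqP -> : minor W j x0 S == 0 by rewrite meval0.
  by apply: contrapT => /negP PS; apply: H; exists S.
have [g [f0 [PE [[S1 f01] f0P]]]] :=
  primitive_part (@gcd_domain_mpoly k (\dim W)) (ex_intro _ S0 PS0).
have g0 : g != 0 by apply: contraNneq PS0 => g0; rewrite PE g0 mul0r.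
have [c fc0] := pihomog_exists f01.
pose f S := pihomog mdeg c (f0 S).
have ff0 : parallel f0 f.
  move=> S T; have := PE; rewrite /f => {}PE.
  have : f0 S * P T = f0 T * P S by rewrite !PE; ring.
  move/(congr1 (pihomog mdeg (c + d * j))).
  rewrite !pihomogM ?minor_homog // !PE !mulrA ![_ * g]mulrC -!mulrA.
  by move/(mulfI g0) => E; rewrite [LHS]mulrC -E mulrC.
have [h hE] := f0P _ ff0.
have h0 : h != 0 by apply: contraNneq fc0 => h0; have := hE S1; rewrite /f => ->; rewrite h0 mulr0.
have [a a0 hC] : exists2 a : k, a != 0 & h = a%:MP.
  by apply: (msize_le_mul f01) h0; rewrite -hE msize_pihomog.
exists f, c; split=> [S|u uW uW']; first exact: pihomogP.
have [x xE] := lift u; have [w0 _] := wedge_vbasis (rankW uW uW').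
have [q qE] : exists q, forall S, minor W j x S = f0 S * q.
  apply: f0P => S T; have := minor_parallel x0 x U0 S T.
  rewrite -/(P S) -/(P T) !PE -!mulrA; exact: mulfI.
have wE : wedge d (vbasis (im u)) = (q.@[hcoord u] / a) *: heval f u.
  apply/ffunP => S; rewrite -(mE u x) // qE !ffunE hE hC !mevalM mevalC.
  rewrite /GRing.scale /=; field; exact: a0.
move: w0; rewrite /pluecker wE scaler_eq0 negb_or => /andP[qa0 ->].
by split=> //; exact: vline_scale.
Qed.
End ImageMorphism.

(** * Zeros and degrees *)

Section ZeroFree.
Variables (k : closedFieldType) (A : vectType k) (W W' : {vspace A}).

Lemma line_restriction (h : {mpoly k[\dim W]}) v w : exists H : {poly k},
  forall t, H.[t] = h.@[hcoord (v + t *: w)].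
Proof.
exists (mmap (@polyC k) (fun i => (hcoord (W := W) v i)%:P + hcoord w i *: 'X) h) => t.
rewrite /mmap horner_sum mevalE; apply: eq_bigr => m _.
rewrite hornerM hornerC; congr (_ * _); rewrite /mmap1 horner_prod.
apply: eq_bigr => i _; rewrite horner_exp hornerD hornerC hornerZ hornerX; congr (_ ^+ _).
by rewrite /hcoord linearD linearZ mulrC.
Qed.

Hypothesis codim2 : forall v0, exists2 v, v \in W & v \notin (<[v0]> + W')%VS.

Lemma codim2_notin : exists2 v, v \in W & v \notin W'.
Proof. by have [v vW] := codim2 0; rewrite add0v => vW'; exists v. Qed.

(* On each line missing W' such a polynomial has no root, so it is constant.  *)
Lemma zero_free_unit (h : {mpoly k[\dim W]}) :
  (forall u, u \in W -> u \notin W' -> h.@[hcoord u] != 0) -> h \is a GRing.unit.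
Proof.
move=> hnz; have line v w : v \in W -> w \in W -> v \notin (<[w]> + W')%VS ->
    h.@[hcoord v] = h.@[hcoord (v + w)].
  move=> vW wW vw; have [H HE] := line_restriction h v w.
  have : size H == 1%N.
    apply/negPn/negP => /closed_rootP[t]; rewrite /root HE; apply/negP; apply: hnz.
      by rewrite memvD ?memvZ.
    apply: contra vw => tW'; rewrite -[v](addrK (t *: w)) addrC memv_add //.
    by rewrite memvN memvZ ?memv_line.
  move=> /size_poly1P[c _ Hc].
  by have := HE 0; have := HE 1; rewrite Hc !hornerC scale1r scale0r addr0 => <- <-.
have [v0 v0W v0W'] := codim2_notin.
have hC : h = (h.@[hcoord v0])%:MP.
  apply/eqP; rewrite -subr_eq0; apply/eqP.
  apply: (@mpoly_dense _ _ _ (<[v0]> + W')%VS); first exact: codim2.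
  move=> v vW vv0; rewrite mevalB mevalC; apply/eqP; rewrite subr_eq0 eq_sym; apply/eqP.
  rewrite (line v0 (v - v0)) ?rpredB //; first by rewrite addrC subrK.
  apply/negP => /memv_addP[_ /vlineP[c ->] [r rW' v0E]].
  have [c0|c0] := eqVneq c 0.
    by rewrite v0E c0 scale0r add0r rW' in v0W'.
  move/negP: vv0; apply; have -> : v = (c^-1 * (1 + c)) *: v0 - c^-1 *: r.
    apply: (scalerI c0); rewrite scalerBr !scalerA mulrA divff // mul1r scale1r.
    by rewrite scalerDl scale1r {1}v0E scalerBr addrAC addrK subrK.
  by rewrite memv_add ?memvZ ?memvN ?memvZ ?memv_line.
by rewrite hC mpolyC_unit // hnz.
Qed.

Variables (I : finType) (X : {pred {vspace A}}) (phi : {vspace A} -> {vspace {ffun I -> k^o}}).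
Hypothesis XP : forall u, (<[u]>%VS \in X) = (u \in W) && (u \notin W').
Implicit Types f g : I -> {mpoly k[\dim W]}.

Lemma represents_is_homogeneous f c : (forall i, f i \is c.-homog) ->
  represents X phi f -> is_homogeneous W X phi.
Proof.
move=> fh fr; split; last by exists f, c.
move=> u uX; exists 1, 0%N, f, c; split=> //; first exact: dhomog1.
  by rewrite meval1 oner_eq0.
by move=> v vX _; exact: fr.
Qed.

Lemma represents_gcd_one f : represents X phi f -> gcd_one f.
Proof.
move=> fr h hf; apply: zero_free_unit => u uW uW'.
have [|fu _] := fr u; first by rewrite XP uW.
apply: contraNneq fu => hu; apply/eqP/ffunP => i; rewrite !ffunE.
by have [q ->] := hf i; rewrite mevalM hu mul0r.
Qed.

Lemma represents_parallel f g : represents X phi f -> represents X phi g -> parallel f g.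
Proof.
move=> fr gr i l; apply/eqP; rewrite -subr_eq0; apply/eqP.
apply: (mpoly_dense codim2_notin) => u uW uW'; rewrite mevalB !mevalM.
have uX : <[u]>%VS \in X by rewrite XP uW.
have [_ fu] := fr u uX; have [_ gu] := gr u uX.
have /vlineP[c gc] : heval g u \in <[heval f u]>%VS by rewrite -fu gu memv_line.
have gE s : (g s).@[hcoord u] = c * (f s).@[hcoord u].
  by have := congr1 (fun z : {ffun I -> k^o} => z s) gc; rewrite !ffunE.
by rewrite !gE; ring.
Qed.

Lemma reduced_representation_degree f g c d :
  reduced_representation X phi f c -> reduced_representation X phi g d -> c = d.
Proof.
move=> [fh fr f1] [gh gr g1]; have [u uW uW'] := codim2_notin.
have uX : <[u]>%VS \in X by rewrite XP uW.
have [i fi] : exists i, f i != 0.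
  apply: contrapT => H; have [/eqP fu _] := fr u uX; apply: fu; apply/ffunP => i.
  rewrite !ffunE; suff /eqP-> : f i == 0 by rewrite meval0.
  by apply: contrapT => /negP fi; apply: H; exists i.
have [s [f0 [fE [_ f0P]]]] :=
  primitive_part (@gcd_domain_mpoly k (\dim W)) (ex_intro _ i fi).
have s0 : s != 0 by apply: contraNneq fi => s0; rewrite fE s0 mul0r.
have su : s \is a GRing.unit by apply: f1 => l; exists (f0 l); exact: fE.
have [a a0 sC] := mpoly_unitC su.
have [h hE] : exists h, forall l, g l = f0 l * h.
  apply: f0P => l m; apply: (mulfI s0); rewrite !mulrA -!fE; exact: represents_parallel.
have hu : h \is a GRing.unit by apply: g1 => l; exists (f0 l); rewrite hE mulrC.
have [b b0 hC] := mpoly_unitC hu.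
have gE : g i = (b / a) *: f i.
  by rewrite hE fE sC hC -mul_mpolyC mulrA -mpolyCM divfK // mulrC.
apply: (dhomog_uniq fi (fh i)).
have -> : f i = (a / b) *: g i.
  rewrite gE scalerA; have -> : a / b * (b / a) = 1 by field; rewrite a0 b0.
  by rewrite scale1r.
exact: rpredZ.
Qed.

Lemma represents_has_degree f c : (forall i, f i \is c.-homog) ->
  represents X phi f -> has_degree W X phi c.
Proof.
move=> fh fr; have fR : reduced_representation X phi f c.
  by split=> //; exact: represents_gcd_one fr.
by split; [exists f|move=> g d gR; exact: reduced_representation_degree gR fR].
Qed.
End ZeroFree.

Lemma represents_restrict (k : closedFieldType) (A : vectType k) (W V : {vspace A})
  (I : finType) (X Y : {pred {vspace A}}) (phi : {vspace A} -> {vspace {ffun I -> k^o}})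
  (f : I -> {mpoly k[\dim W]}) (c : nat) :
  (V <= W)%VS -> (forall u, <[u]>%VS \in Y -> u \in V /\ <[u]>%VS \in X) ->
  (forall i, f i \is c.-homog) -> represents X phi f ->
  exists g : I -> {mpoly k[\dim V]},
    (forall i, g i \is c.-homog) /\ represents Y phi g.
Proof.
move=> VW YX fh fr.
pose lq : (\dim W).-tuple {mpoly k[\dim V]} :=
  [tuple \sum_(l < \dim V) hcoord (W := W) (vbasis V)`_l i *: 'X_l | i < \dim W].
exists (fun i => f i \mPo lq); split=> [i|u uY].
  apply: dhomog_comp (fh i) => l; rewrite tnth_mktuple; apply: rpred_sum => m _.
  by apply: rpredZ; rewrite dhomogX; apply/eqP; exact: mdeg1.
have [uV uX] := YX u uY; suff -> : heval (fun i => f i \mPo lq) u = heval f u by exact: fr.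
apply/ffunP => i; rewrite !ffunE comp_mpoly_meval; apply: meval_eq => l.
rewrite tnth_mktuple raddf_sum /= /hcoord [in RHS](coord_vbasis uV) linear_sum.
by apply: eq_bigr => m _; rewrite mevalZ mevalXU linearZ /= mulrC.
Qed.

(** * The abelian unipotent rank *)

Section UnipotentRank.
Variables (k : fieldType) (p : nat) (hp : p \in [pchar k]).
Variables (E : finGroupScheme k) (frobE : forall x : measures E, frob_trivial p x).
Variables (n : nat) (phi : {lrmorphism {mpoly k[n]} -> measures E}).
Hypothesis phi_surj : forall x, exists q, phi q = x.
Hypothesis phi_ker : forall q, phi q = 0 <->
  exists g : 'I_n -> {mpoly k[n]}, q = \sum_i g i * 'X_i ^+ p.
Local Notation A := (measures E).

Let p_prime : prime p. Proof. exact: pcharf_prime hp. Qed.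
Let p_gt0 : (0 < p)%N. Proof. exact: prime_gt0. Qed.

Lemma phiX1 i : phi 'X_i 1 = 0.
Proof.
have : phi ('X_i ^+ p) = 0.
  apply/phi_ker; exists (fun l => (l == i)%:R); rewrite (bigD1 i) //= eqxx mul1r.
  by rewrite big1 ?addr0 // => l /negbTE->; rewrite mul0r.
rewrite rmorphXn => /(congr1 (fun x : A => x 1)); rewrite measureX1 zero_lfunE.
by move/eqP; rewrite expf_eq0 => /andP[_ /eqP].
Qed.

Lemma phi_eval1 q : phi q 1 = q.@[fun=> 0].
Proof.
elim/mpolyind: q => [|c m q _ _ IH]; first by rewrite rmorph0 meval0 zero_lfunE.
rewrite linearD linearZ mevalD mevalZ add_lfunE scale_lfunE IH; congr (_ * _ + _).
rewrite mevalX mpolyXE_id rmorph_prod.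
elim/big_rec2: _ => [|i y x _ IHx]; first by rewrite measure11.
by rewrite measureM1 IHx rmorphXn measureX1 phiX1.
Qed.

Lemma Rad2_lift x : x \in Rad2 E -> exists q, [/\ phi q = x,
  q.@[fun=> 0] = 0 & forall i, (q^`M(i)).@[fun=> 0] = 0].
Proof.
rewrite /Rad2 unlock => xR; rewrite (coord_span xR).
have RadP y : y \in Rad A -> exists2 q, phi q = y & q.@[fun=> 0] = 0.
  rewrite (mem_RadE hp frobE) => /eqP y0; have [q qE] := phi_surj y.
  by exists q => //; rewrite -phi_eval1 qE.
elim/big_rec: _ => [|i y _ [q [qE q0 dq]]].
  by exists 0; split=> [||i]; rewrite ?rmorph0 ?mderiv0 ?meval0.
have := mem_tnth i (allpairs_tuple *%R (vbasis (Rad A)) (vbasis (Rad A))).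
rewrite (tnth_nth 0) => /allpairsP[[u v] /= [uR vR ->]].
have [a aE a0] := RadP u (vbasis_mem uR); have [b bE b0] := RadP v (vbasis_mem vR).
set c := coord _ _ _; exists (c *: (a * b) + q); split=> [||l].
- by rewrite linearD linearZ rmorphM /= aE bE qE.
- by rewrite mevalD mevalZ mevalM a0 mul0r mulr0 add0r.
- by rewrite mderivD mderivZ mderivM mevalD mevalZ mevalD !mevalM a0 b0 dq mulr0 mul0r !addr0 mulr0.
Qed.

Lemma phiX_independent (i l : 'I_n) (a b : k) : i != l ->
  a *: phi 'X_i + b *: phi 'X_l \in Rad2 E -> a = 0.
Proof.
move=> il /Rad2_lift[q [qE q0 dq]].
have /phi_ker[g gE] : phi (a *: 'X_i + b *: 'X_l - q) = 0.
  by rewrite linearB linearD !linearZ /= qE subrr.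
have := congr1 (fun r => (r^`M(i)).@[fun=> 0]) gE.
rewrite mderivB mderivD !mderivZ mevalB mevalD !mevalZ dq subr0.
rewrite !mderivX !mnm1E eqxx eq_sym (negbTE il) scale0r scale1r meval0 mulr0 addr0.
have -> : (U_(i) - U_(i) = 0)%MM by apply/mnmP => s; rewrite mnmBE mnm0E subnn.
rewrite mpolyX0 meval1 mulr1 => ->.
rewrite (raddf_sum (mderiv i)) raddf_sum big1 // => s _ /=.
have -> : ('X_s : {mpoly k[n]}) ^+ p = 'X_[U_(s) *+ p] by rewrite mpolyXn.
rewrite mderivM mderivX mulmnE mevalD !mevalM mevalX (bigD1 s) //= mulmnE mnm1E eqxx mul1n.
rewrite expr0n gtn_eqF // mul0r mulr0 add0r mevalZ natrM.
by rewrite (pcharf0 hp) mulr0 mul0r mulr0.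
Qed.

Lemma codim2_Rad : (2 <= n)%N ->
  forall v0, exists2 v, v \in Rad A & v \notin (<[v0]> + Rad2 E)%VS.
Proof.
move=> n2 v0; pose i0 := Ordinal (ltnW n2); pose i1 := Ordinal n2.
have XR i : phi 'X_i \in Rad A by rewrite (mem_RadE hp frobE) phiX1.
have [v1|] := boolP (phi 'X_i1 \in (<[v0]> + Rad2 E)%VS); last by exists (phi 'X_i1).
exists (phi 'X_i0) => //; apply/negP => /memv_addP[_ /vlineP[c ->] [r rR E0]].
have /memv_addP[_ /vlineP[c' ->] [r' r'R E1]] := v1.
have c0 : c = 0.
  have := @phiX_independent i1 i0 c (- c') isT; apply.
  rewrite E0 E1 !scalerDr !scalerA mulNr [c' * c]mulrC scaleNr addrACA subrr add0r.
  by rewrite rpredD ?rpredZ.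
have := @phiX_independent i0 i1 1 0 isT.
rewrite scale1r scale0r addr0 E0 c0 scale0r add0r => /(_ rR)/eqP.
by rewrite oner_eq0.
Qed.
End UnipotentRank.

Theorem theorem6p2p3 (k : closedFieldType) (p : nat) (hp : p \in [pchar k])
    (E : finGroupScheme k) (hE : elementary_abelian p E)
    (j : nat) (hj : (0 < j < p)%N)
    (M : fdModule (measures E)) (hM : constant_jrank p M j) :
  ((forall L, L \in U_set E -> Im_map M j L \in Gr M (jrank p M j)) /\
   is_homogeneous (Rad (measures E)) (U_set E)
     (fun L => pluecker (jrank p M j) (Im_map M j L))) /\
  (forall n : nat, abelian_unipotent_rank p E n -> (2 <= n)%N ->
   forall V : {vspace measures E},
     (V + Rad2 E)%VS = Rad (measures E) -> (V :&: Rad2 E)%VS = 0%VS ->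
     (forall L, L \in proj_space V -> L \in U_set E) /\
     exists d : nat,
       has_degree (Rad (measures E)) (U_set E)
         (fun L => pluecker (jrank p M j) (Im_map M j L)) d /\
       has_degree V (proj_space V)
         (fun L => pluecker (jrank p M j) (Im_map M j L)) d).
Proof.
have abE : abelian_scheme E by case: hE.
have frobE := elementary_frob_trivial hp hE.
have rankE := constant_jrankE hp abE frobE hM.
set R := Rad (measures E); set d := jrank p M j in rankE *.
have lineE (W : {vspace measures E}) L : L \in proj_space W ->
    exists u, [/\ u != 0, u \in W & L = <[u]>%VS].
  rewrite inE => /andP[LW /eqP L1]; have L0 : L != 0%VS by rewrite -dimv_eq0 L1.
  exists (vpick L); rewrite vpick0 L0 (subvP LW) ?memv_pick //; split=> //.
  by apply/eqP; rewrite eq_sym eqEdim -memvE memv_pick L1 dim_vline vpick0 L0.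
have UE := @in_U_set k E.
have U0 u : u \in R -> u \notin Rad2 E -> u != 0.
  by move=> _; apply: contraNneq => ->; rewrite mem0v.
have [f [c [fh fP]]] := image_homogeneous rankE.
pose phi L := pluecker d (Im_map M j L).
have fr : represents (U_set E) phi f.
  move=> u; rewrite UE => /andP[uR uR2].
  by rewrite /phi Im_mapE ?(U0 u) //; exact: fP.
split.
  split; last exact: (represents_is_homogeneous (X := U_set E) fh fr).
  move=> L LU; have : L \in proj_space R by case/andP: LU.
  move=> /lineE[u [u0 uR LE]]; rewrite LE UE in LU *; case/andP: LU => _ uR2.
  by rewrite Im_mapE // inE rankE.
move=> n [psi [psi_surj psi_ker]] n2 V VR VR2.
have codim := codim2_Rad hp frobE psi_surj psi_ker n2.
have VsubR : (V <= R)%VS by rewrite -VR addvSl.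
have VU u : u \in V -> u != 0 -> <[u]>%VS \in U_set E.
  move=> uV u0; rewrite UE (subvP VsubR) //=; apply: contra u0 => uR2.
  by rewrite -memv0 -VR2 memv_cap uV.
have PV u : (<[u]>%VS \in proj_space V) = (u \in V) && (u \notin 0%VS).
  by rewrite inE -memvE dim_vline memv0 eqb1.
split=> [L /lineE[u [u0 uV ->]]|]; first exact: VU.
exists c; split; first exact: (represents_has_degree codim UE fh fr).
have codimV v0 : exists2 v, v \in V & v \notin (<[v0]> + 0)%VS.
  have [w wR wv0] := codim v0; move: wR; rewrite -/R -VR => /memv_addP[v vV [r rR2 wE]].
  exists v => //; apply: contra wv0; rewrite addv0 => vv0.
  by rewrite wE memv_add.
have YX u : <[u]>%VS \in proj_space V -> u \in V /\ <[u]>%VS \in U_set E.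
  by rewrite PV memv0 => /andP[uV u0]; split=> //; exact: VU.
have [g [gh gr]] := represents_restrict VsubR YX fh fr.
exact: (represents_has_degree codimV PV gh gr).
Qed.
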